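(* The map $\Phi$ which sends a vertex of the Apollonian kingdom, labelled by the lax lattice with ordered basis $(a,b)$, to the oriented circle $M(\mathbb{R})$ where $M=\begin{pmatrix} a & b\end{pmatrix}$ has columns $a,b$, is a well-defined bijection from the set of vertices of the Apollonian kingdom to the set of oriented Gaussian circles.
   Context: Units of $\mathbb{Z}[i]$ are $\{\pm1,\pm i\}$. A lax vector is a primitive vector of $\mathbb{Z}[i]^2$ (coprime entries) up to multiplication by units. A basis is a pair of lax vectors whose representatives form a $\mathbb{Z}[i]$-basis of $\mathbb{Z}[i]^2$; a superbasis is a triple of lax vectors any two of which form a basis. An ultrabasis is a set of six lax vectors $u,v,w,x,y,z$ such that $\{u,v,w\},\{u,y,z\},\{v,x,z\},\{w,x,y\}$ are superbases; it is regarded as a chamber: a tetrahedron whose edges are labelled by the six lax vectors so that its four triangular faces (walls) carry these superbases. Every superbasis has representatives $u,v,w$ with $u+v+w=0$, and the chambers containing it as a wall are exactly the left standard chamber (edges $u,v,w,u+iv,v+iw,w+iu$; walls $\{u,v,w\},\{u,u+iv,w+iu\},\{v,v+iw,u+iv\},\{w,w+iu,v+iw\}$) and the right standard chamber (edges $u,v,w,u-iv,v-iw,w-iu$; walls $\{u,v,w\},\{u,u-iv,w-iu\},\{v,v-iw,u-iv\},\{w,w-iu,v-iw\}$). The Apollonian kingdom is the graph obtained from all chambers by gluing along common walls. Lax lattices: for an ordered $\mathbb{Z}[i]$-basis $(a,b)$ of $\mathbb{Z}[i]^2$, $L=\mathbb{Z}a+\mathbb{Z}b$ is oriented by $(a,b)$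 (determinant $1$ changes of $\mathbb{Z}$-basis preserve orientation, determinant $-1$ reverse it); the lax lattice is $\{L,iL\}$. Vertex labels: in a left standard chamber with $u+v+w=0$ the vertex at edges $u,v,u+iv$ carries $(u,iv)$; at $v,w,v+iw$ carries $(v,iw)$; at $w,u,w+iu$ carries $(w,iu)$; at $u+iv,v+iw,w+iu$ carries $(w-iv,iu-v)$; in the right standard chamber the vertices of wall $\{u,v,w\}$ carry the same labels and the vertex at $u-iv,v-iw,w-iu$ carries $(w+iv,iu+v)$. These labels are independent of the choices made. Circles in $\mathbb{C}_\infty$ include lines; $\mathbb{R}$ is oriented toward $+\infty$; $\mathrm{PGL}_2(\mathbb{Z}[i])$ (matrices over $\mathbb{Z}[i]$ with unit determinant, modulo unit scalars) acts by M\''obius transformations on oriented circles (orientation transported via the order of image points). An oriented Gaussian circle is an oriented circle $M(\mathbb{R})$ with $M\in\mathrm{PGL}_2(\mathbb{Z}[i])$. *)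

(* Defs.v *)
From HB Require Import structures.
From Stdlib Require Import Relation_Operators.
From mathcomp Require Import all_boot all_order all_algebra.
From mathcomp Require Import mathcomp_extra boolp classical_sets reals complex.
From mathcomp Require Import ring lra zify.

Set Implicit Arguments.
Unset Strict Implicit.
Unset Printing Implicit Defensive.

Import Order.TTheory GRing.Theory Num.Theory.

Local Open Scope classical_set_scope.
Local Open Scope ring_scope.
Local Open Scope complex_scope.

Record gint := GInt { gre : int; gim : int }.

Definition gint_to_pair (x : gint) : int * int := (gre x, gim x).
Definition pair_to_gint (p : int * int) : gint := GInt p.1 p.2.

Lemma gint_to_pairK : cancel gint_to_pair pair_to_gint.
Proof. by case. Qed.

HB.instance Definition _ := Countable.copy gint (can_type gint_to_pairK).

Definition gint_add (x y : gint) := GInt (gre x + gre y) (gim x + gim y).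
Definition gint_opp (x : gint) := GInt (- gre x) (- gim x).
Definition gint_mul (x y : gint) :=
  GInt (gre x * gre y - gim x * gim y) (gre x * gim y + gim x * gre y).

Lemma gint_addA : associative gint_add.
Proof. by move=> x y z; congr GInt; rewrite /= addrA. Qed.

Lemma gint_addC : commutative gint_add.
Proof. by move=> x y; congr GInt; rewrite /= addrC. Qed.

Lemma gint_add0 : left_id (GInt 0 0) gint_add.
Proof. by case=> a b; congr GInt; rewrite /= add0r. Qed.

Lemma gint_addN : left_inverse (GInt 0 0) gint_opp gint_add.
Proof. by case=> a b; congr GInt; rewrite /= addNr. Qed.

HB.instance Definition _ := GRing.isZmodule.Build gint
  gint_addA gint_addC gint_add0 gint_addN.

Lemma gint_mulA : associative gint_mul.
Proof. by move=> x y z; congr GInt => /=; ring. Qed.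

Lemma gint_mulC : commutative gint_mul.
Proof. by move=> x y; congr GInt => /=; ring. Qed.

Lemma gint_mul1 : left_id (GInt 1 0) gint_mul.
Proof. by case=> a b; congr GInt => /=; ring. Qed.

Lemma gint_mulDl : left_distributive gint_mul gint_add.
Proof. by move=> x y z; congr GInt => /=; ring. Qed.

Lemma gint_oner_neq0 : GInt 1 0 != 0.
Proof. by []. Qed.

HB.instance Definition _ := GRing.Zmodule_isComNzRing.Build gint
  gint_mulA gint_mulC gint_mul1 gint_mulDl gint_oner_neq0.

Definition gI : gint := GInt 0 1.

Definition gint_unit : {pred gint} := [pred x in [:: 1; -1; gI; - gI]].
Definition gint_inv (x : gint) : gint :=
  if x \in gint_unit then GInt (gre x) (- gim x) else x.

Lemma gint_mulVx : {in gint_unit, left_inverse 1 gint_inv *%R}.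
Proof.
move=> x xu; rewrite /gint_inv xu.
by move: xu; rewrite !inE => /or4P[] /eqP ->.
Qed.

Lemma gint_unitPl x y : y * x = 1 -> x \in gint_unit.
Proof.
case: x y => [a b] [c d] [e1 e2].
have n1 : (c * c + d * d) * (a * a + b * b) = 1 :> int.
  transitivity ((c * a - d * b) * (c * a - d * b) +
                (c * b + d * a) * (c * b + d * a)); first by ring.
  by rewrite e1 e2.
have n2 : a * a + b * b = 1.
  have m0 : 0 <= a * a + b * b by nia.
  have n0 : 0 <= c * c + d * d by nia.
  move: n1 m0 n0; set m := a * a + b * b; set n := c * c + d * d.
  move: m n => m n mn m0 n0.
  have m1 : 1 <= m by nia.
  have n1 : 1 <= n by nia.
  by nia.
have a1 : a = 0 \/ a = 1 \/ a = -1.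
  have : -1 <= a <= 1 by nia.
  by lia.
have b1 : b = 0 \/ b = 1 \/ b = -1.
  have : -1 <= b <= 1 by nia.
  by lia.
by case: a1 n2 => [|[]] -> ; case: b1 => [|[]] ->.
Qed.

Lemma gint_inv_out : {in [predC gint_unit], gint_inv =1 id}.
Proof. by move=> x; rewrite inE /gint_inv => /negbTE ->. Qed.

HB.instance Definition _ := GRing.ComNzRing_hasMulInverse.Build gint
  gint_mulVx gint_unitPl gint_inv_out.

Definition gvec := 'cV[gint]_2.

Definition gdvd (d x : gint) : Prop := exists q, x = q * d.

Definition primitive (v : gvec) : Prop :=
  forall d, gdvd d (v 0 0) -> gdvd d (v 1 0) -> d \is a GRing.unit.

Definition gbasis (a b : gvec) : Prop :=
  forall w : gvec, exists! xy : gint * gint, w = xy.1 *: a + xy.2 *: b.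

(* A lax vector is the full set of unit multiples of a primitive vector. *)
Definition lax (v : gvec) : set gvec :=
  [set w | exists2 e : gint, e \is a GRing.unit & w = e *: v].

Definition is_lax (A : set gvec) : Prop := exists2 v, primitive v & A = lax v.

Definition lax_basis (A B : set gvec) : Prop :=
  [/\ is_lax A, is_lax B & forall a b, A a -> B b -> gbasis a b].

Definition superbasis (A B C : set gvec) : Prop :=
  [/\ lax_basis A B, lax_basis A C & lax_basis B C].

(* The labelled tetrahedron: opposite edges are u-x, v-y and w-z. *)
Definition ultrabasis (u v w x y z : set gvec) : Prop :=
  uniq [:: u; v; w; x; y; z] /\
  [/\ superbasis u v w, superbasis u y z, superbasis v x z & superbasis w x y].

Definition wall := set (set gvec).

Definition walls (u v w x y z : set gvec) : set wall :=
  [set [set u; v; w]; [set u; y; z]; [set v; x; z]; [set w; x; y]].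

(* The four vertices of the tetrahedron, each given by the three edges meeting
   there.  In an ultrabasis these triples are superbases too, so the six labels
   alone do not determine which triples are walls: a chamber is its set of
   walls, not its set of edges. *)
Definition corners (u v w x y z : set gvec) : set (set (set gvec)) :=
  [set [set u; v; z]; [set v; w; x]; [set w; u; y]; [set x; y; z]].

Record corner := Corner {
  chamber : set wall;
  corner_edges : set (set gvec);
  cornerP : exists u v w x y z : set gvec,
    [/\ ultrabasis u v w x y z, chamber = walls u v w x y z
      & corners u v w x y z corner_edges] }.

(* A vertex of a wall is determined by the two edges of the wall meeting there;
   the vertex opposite to a wall meets none of its edges.  Gluing along a common
   wall matches the edges with the same label. *)
Definition glued (c d : corner) : Prop :=
  exists W : wall,
    [/\ chamber c W, chamber d W,
        corner_edges c `&` W !=set0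
      & corner_edges c `&` W = corner_edges d `&` W].

Definition glue_class (c : corner) : set corner :=
  [set d | clos_refl_sym_trans corner glued c d].

Definition kingdom_vertex := {x : set corner | exists c, x = glue_class c}.

Record oriented_lattice := OrientedLattice {
  lattice_points : set gvec;
  positive_bases : set (gvec * gvec) }.

Definition olattice (a b : gvec) : oriented_lattice := {|
  lattice_points := [set w | exists m n : int, w = a *~ m + b *~ n];
  positive_bases := [set ab | exists p q r s : int,
    [/\ p * s - q * r = 1, ab.1 = a *~ p + b *~ q
      & ab.2 = a *~ r + b *~ s]] |}.

Definition lax_lattice (a b : gvec) : set oriented_lattice :=
  [set olattice a b; olattice (gI *: a) (gI *: b)].

Definition left_walls (u v w : gvec) : set wall :=
  walls (lax u) (lax v) (lax w)
    (lax (v + gI *: w)) (lax (w + gI *: u)) (lax (u + gI *: v)).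

Definition right_walls (u v w : gvec) : set wall :=
  walls (lax u) (lax v) (lax w)
    (lax (v - gI *: w)) (lax (w - gI *: u)) (lax (u - gI *: v)).

Definition left_label (E : set (set gvec)) (u v w a b : gvec) : Prop :=
  [\/ E = [set lax u; lax v; lax (u + gI *: v)] /\ (a, b) = (u, gI *: v),
      E = [set lax v; lax w; lax (v + gI *: w)] /\ (a, b) = (v, gI *: w),
      E = [set lax w; lax u; lax (w + gI *: u)] /\ (a, b) = (w, gI *: u)
    | E = [set lax (u + gI *: v); lax (v + gI *: w); lax (w + gI *: u)] /\
      (a, b) = (w - gI *: v, gI *: u - v)].

Definition right_label (E : set (set gvec)) (u v w a b : gvec) : Prop :=
  [\/ E = [set lax u; lax v; lax (u - gI *: v)] /\ (a, b) = (u, gI *: v),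
      E = [set lax v; lax w; lax (v - gI *: w)] /\ (a, b) = (v, gI *: w),
      E = [set lax w; lax u; lax (w - gI *: u)] /\ (a, b) = (w, gI *: u)
    | E = [set lax (u - gI *: v); lax (v - gI *: w); lax (w - gI *: u)] /\
      (a, b) = (w + gI *: v, gI *: u + v)].

(* Labels are a relation: a corner is labelled through every presentation of
   its chamber as a left or right standard chamber. *)
Definition carries (c : corner) (a b : gvec) : Prop :=
  exists u v w : gvec,
    [/\ u + v + w = 0, superbasis (lax u) (lax v) (lax w)
      & (chamber c = left_walls u v w /\
           left_label (corner_edges c) u v w a b) \/
        (chamber c = right_walls u v w /\
           right_label (corner_edges c) u v w a b)].

Definition vertex_label (x : kingdom_vertex) (L : set oriented_lattice) :
    Prop :=
  exists c a b, [/\ sval x c, carries c a b & L = lax_lattice a b].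

(* None is the point at infinity. *)
Definition sphere (R : realType) := option R[i].

Definition mobius (R : realType) (M : 'M[R[i]]_2) (z : sphere R) : sphere R :=
  let: (n, d) :=
    if z is Some t then (M 0 0 * t + M 0 1, M 1 0 * t + M 1 1)
    else (M 0 0, M 1 0) in
  if d == 0 then None else Some (n / d).

(* An orientation is recorded as the set of positively ordered triples of
   distinct points.  The curves used below are circles or lines: see
   is_circle_mobius. *)
Record oriented_curve (R : realType) := OrientedCurve {
  carrier : set (sphere R);
  positive_triples : set (sphere R * sphere R * sphere R) }.

(* The real line closed up by None, in increasing order with None last. *)
Definition lt_ext (R : realType) (x y : option R) : bool :=
  match x, y with
  | Some a, Some b => a < b
  | Some _, None => true
  | None, _ => false
  end.

Definition cyclic_lt (R : realType) (x y z : option R) : bool :=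
  [|| lt_ext x y && lt_ext y z, lt_ext y z && lt_ext z x
    | lt_ext z x && lt_ext x y].

Definition real_point (R : realType) (x : option R) : sphere R :=
  omap (fun t : R => t%:C) x.

Definition real_circle (R : realType) : oriented_curve R := {|
  carrier := range (@real_point R);
  positive_triples := [set t | exists x y z : option R,
    cyclic_lt x y z /\ t = (real_point x, real_point y, real_point z)] |}.

Definition mobius_curve (R : realType) (M : 'M[R[i]]_2)
    (o : oriented_curve R) : oriented_curve R := {|
  carrier := mobius M @` carrier o;
  positive_triples :=
    (fun t => (mobius M t.1.1, mobius M t.1.2, mobius M t.2))
      @` positive_triples o |}.

Definition gint_to_C (R : realType) (x : gint) : R[i] :=
  (gre x)%:~R +i* (gim x)%:~R.

Definition gaussian_image (R : realType) (M : 'M[gint]_2) : oriented_curve R :=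
  mobius_curve (map_mx (@gint_to_C R) M) (real_circle R).

(* Unit scalars act trivially (mobius_scale), so M may range over GL_2. *)
Definition gaussian_circle (R : realType) :=
  {o : oriented_curve R | exists2 M : 'M[gint]_2,
     M \in unitmx & o = gaussian_image R M}.

Lemma mobius_scale (R : realType) (k : R[i]) (M : 'M[R[i]]_2) :
  k != 0 -> mobius (k *: M) =1 mobius M.
Proof.
move=> k0 [t|]; rewrite /mobius !mxE.
  rewrite -!mulrA -!mulrDr mulf_eq0 (negbTE k0) /=.
  by case: eqP => // _; rewrite -mulf_div divff // mul1r.
rewrite mulf_eq0 (negbTE k0) /=.
by case: eqP => // _; rewrite -mulf_div divff // mul1r.
Qed.

(* A x^2 + A y^2 + 2 B x + 2 C y + D = 0 with B^2 + C^2 > A D: a circle of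
   positive radius if A != 0, a line through infinity if A = 0. *)
Definition is_circle (R : realType) (S : set (sphere R)) : Prop :=
  exists A B C D : R, A * D < B ^+ 2 + C ^+ 2 /\
    S = [set p | if p is Some (x +i* y) then
           A * (x ^+ 2 + y ^+ 2) + 2 * (B * x + C * y) + D = 0 else A = 0].

Lemma is_circle_mobius (R : realType) (M : 'M[R[i]]_2) :
  M \in unitmx -> is_circle (carrier (mobius_curve M (real_circle R))).
Proof.
have detM : \det M = M 0 0 * M 1 1 - M 0 1 * M 1 0.
  rewrite (expand_det_row _ 0) !big_ord_recl big_ord0 /cofactor !det_mx11 !mxE.
  rewrite /= addr0 expr0 expr1 mul1r mulN1r mulrN.
  by congr (_ * M _ _ - M _ _ * M _ _); apply/val_inj.
rewrite unitmxE unitfE detM {detM}.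
move Ea: (M 0 0) => a; move Eb: (M 0 1) => b.
move Ec: (M 1 0) => c; move Ed: (M 1 1) => d dM.
have im_real (k : R[i]) : (exists t : R, k = t%:C) <-> complex.Im k = 0.
  by case: k => k1 k2 /=; split=> [[t [_ ->]]|->] //; exists k1.
have imP (p : sphere R) : carrier (mobius_curve M (real_circle R)) p <->
    if p is Some z then complex.Im ((d * z - b) * (a - c * z)^*) = 0
    else complex.Im (d * c^*) = 0.
  have mulJ (k : R[i]) : complex.Im (k * k^*) = 0.
    by case: k => k1 k2 /=; ring.
  have ImM (k : R) (l : R[i]) : complex.Im (k%:C * l) = k * complex.Im l.
    by case: l => l1 l2 /=; ring.
  have quot (k l : R[i]) : l != 0 -> complex.Im (k * l^*) = 0 ->
      exists t : R, k = t%:C * l.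
    move=> l0 kl.
    have [t tE] : exists t : R, k / l = t%:C.
      apply/im_real; move: l0 kl; case: k => k1 k2; case: l => l1 l2 l0 /= kl.
      transitivity ((k1 * - l2 + k2 * l1) / (l1 ^+ 2 + l2 ^+ 2)); first by ring.
      by rewrite kl mul0r.
    by exists t; rewrite -tE divfK.
  rewrite /= /mobius Ea Eb Ec Ed; split.
    case=> _ [[t|] _ <-] /=.
      case: eqP => [ct|/eqP ct <-].
        move=> <-; have -> : d = (- t)%:C * c.
          by apply: (addrI (c * t%:C)); rewrite ct rmorphN; ring.
        by rewrite -mulrA ImM mulJ mulr0.
      have -> : d * ((a * t%:C + b) / (c * t%:C + d)) - b =
          t%:C * (a - c * ((a * t%:C + b) / (c * t%:C + d))).
        by field.
      by rewrite -mulrA ImM mulJ mulr0.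
    case: eqP => [-> <-|/eqP c0 <-]; first by rewrite rmorph0 mulr0.
    have -> : a - c * (a / c) = 0 by rewrite mulrCA divff // mulr1 subrr.
    by rewrite rmorph0 mulr0.
  case: p => [z|] /= h.
    have [az|az] := eqVneq (a - c * z) 0.
      have c0 : c != 0.
        apply: contraNneq dM => c0; move: az.
        by rewrite c0 mul0r subr0 => ->; rewrite mul0r mulr0 subr0.
      exists None; first by exists None.
      move/eqP: az; rewrite subr_eq0 => /eqP ->.
      by rewrite (negbTE c0) mulrAC divff // mul1r.
    have [t tE] := quot _ _ az h.
    have tE' : z * (c * t%:C + d) = a * t%:C + b.
      by apply/eqP; rewrite -subr_eq0; apply/eqP;
         transitivity (d * z - b - t%:C * (a - c * z));
         [ring | rewrite tE subrr].
    have ct : c * t%:C + d != 0.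
      apply: contraNneq dM => ct; move: tE'; rewrite ct mulr0 => /esym at_.
      have -> : d = - (c * t%:C) by apply/eqP; rewrite -addr_eq0 addrC ct.
      have -> : b = - (a * t%:C) by apply/eqP; rewrite -addr_eq0 addrC at_.
      by apply/eqP; ring.
    exists (Some t%:C); first by exists (Some t).
    by rewrite (negbTE ct) -tE' mulfK.
  have [c0|c0] := eqVneq c 0.
    by exists None; [exists None | rewrite c0 eqxx].
  have [t tE] := quot _ _ c0 h.
  exists (Some (- t)%:C); first by exists (Some (- t)).
  by rewrite tE rmorphN mulrN mulrC addNr eqxx.
move: dM imP {Ea Eb Ec Ed}.
case: a b c d => [a1 a2] [b1 b2] [c1 c2] [d1 d2] dM imP.
exists (d1 * c2 - d2 * c1), (((d2 * a1 + b2 * c1) - (d1 * a2 + b1 * c2)) / 2),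
  (((d1 * a1 + d2 * a2) - (b1 * c1 + b2 * c2)) / 2), (b1 * a2 - b2 * a1).
split; last first.
  apply/seteqP; split=> [p /imP|p hp].
    case: p => [[x y]|] /= h; first by rewrite -[RHS]h; field.
    by apply/oppr_inj; rewrite oppr0 -[RHS]h; ring.
  apply/imP; case: p hp => [[x y]|] /= h; first by rewrite -[RHS]h; field.
  by apply/oppr_inj; rewrite oppr0 -[RHS]h; ring.
rewrite -subr_gt0.
set e1 := a1 * d1 - a2 * d2 - (b1 * c1 - b2 * c2).
set e2 := a1 * d2 + a2 * d1 - (b1 * c2 + b2 * c1).
have -> : (((d2 * a1 + b2 * c1) - (d1 * a2 + b1 * c2)) / 2) ^+ 2 +
    (((d1 * a1 + d2 * a2) - (b1 * c1 + b2 * c2)) / 2) ^+ 2 -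
    (d1 * c2 - d2 * c1) * (b1 * a2 - b2 * a1) = (e1 ^+ 2 + e2 ^+ 2) / 4.
  by rewrite /e1 /e2; field.
have : (e1 != 0) || (e2 != 0).
  rewrite -negb_and; move: dM; apply: contraNN => /andP[/eqP h1 /eqP h2].
  rewrite eq_complex /=; apply/andP; split; apply/eqP.
    by rewrite -[RHS]h1 /e1; ring.
  by rewrite -[RHS]h2 /e2; ring.
move=> e0; rewrite divr_gt0 ?ltr0n //.
rewrite lt_neqAle addr_ge0 ?sqr_ge0 // andbT eq_sym.
by rewrite paddr_eq0 ?sqr_ge0 // !sqrf_eq0 negb_and.
Qed.

(* Main.v *)
From HB Require Import structures.
From Stdlib Require Import Relation_Operators.
Require Import Defs.
From mathcomp Require Import all_boot all_order all_algebra.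
From mathcomp Require Import boolp classical_sets reals complex.
From mathcomp Require Import ring lra zify.

(** A corner of a chamber whose three edges are [a], [b], [a + b], oriented so
    that its label is [(a, b)], is determined by the pair [(a, b)]
    ([std_corner]), and every corner is of this form.  The pairs [(a, b)],
    [(b, - a - b)] and their unit multiples give the same corner, while the
    corners of [(a, b)] and [(- b, a)] are glued along the wall
    [{a, b, a - i b}]: the corners around a vertex are the superbases of the
    lattice [Z a + Z b], arranged as in Conway's topograph.  Since the matrices
    of these two moves generate [SL_2(Z)], two corners are glued exactly when
    their pairs differ by [SL_2(Z)] and a unit ([lax_equiv]).

    On the other side, if [M(R)] and [M'(R)] agree as oriented circles, then
    [M^-1 M'] is a complex multiple [l] of a real matrix of determinant
    [d > 0].  Its determinant [l^2 d] is a unit of [Z[i]], so [l] lies on an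
    axis or on a diagonal; a diagonal would make the determinant even, so
    [M^-1 M'] is a unit times an element of [SL_2(Z)]. *)

Set Implicit Arguments.
Unset Strict Implicit.
Unset Printing Implicit Defensive.

Import Order.TTheory GRing.Theory Num.Theory.

Local Open Scope classical_set_scope.
Local Open Scope ring_scope.
Local Open Scope complex_scope.

(** * Bases and lax vectors *)

Lemma gI2 : gI * gI = -1.
Proof. by []. Qed.

Definition gdet (a b : gvec) : gint := a 0 0 * b 1 0 - a 1 0 * b 0 0.

Lemma gvecP (a b : gvec) : a 0 0 = b 0 0 -> a 1 0 = b 1 0 -> a = b.
Proof.
move=> e0 e1; apply/matrixP => i j; rewrite (ord1 j) {j}.
by case: i => [[|[|//]] Hi]; [move: e0 | move: e1];
  congr (_ = _); congr (fun_of_matrix _ _ _); apply: val_inj.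
Qed.

Lemma gdetZl (e : gint) (a b : gvec) : gdet (e *: a) b = e * gdet a b.
Proof. by rewrite /gdet !mxE; ring. Qed.

Lemma gdetZr (e : gint) (a b : gvec) : gdet a (e *: b) = e * gdet a b.
Proof. by rewrite /gdet !mxE; ring. Qed.

Lemma gdet_comb (a b : gvec) (p q r s : gint) :
  gdet (p *: a + q *: b) (r *: a + s *: b) = (p * s - q * r) * gdet a b.
Proof. by rewrite /gdet !mxE; ring. Qed.

Lemma gdet_combr (a b : gvec) (r s : gint) :
  gdet a (r *: a + s *: b) = s * gdet a b.
Proof. by rewrite /gdet !mxE; ring. Qed.

Lemma gdet_combl (a b : gvec) (p q : gint) :
  gdet (p *: a + q *: b) b = p * gdet a b.
Proof. by rewrite /gdet !mxE; ring. Qed.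

Lemma gdetC (a b : gvec) : gdet b a = - gdet a b.
Proof. by rewrite /gdet; ring. Qed.

(** The coordinates of the two standard vectors form an inverse of the matrix with columns [a], [b];
    conversely Cramer's rule gives the unique coordinates. *)
Lemma gbasisP (a b : gvec) : gbasis a b <-> gdet a b \is a GRing.unit.
Proof.
split=> [h|h w].
  have [[p q] [/= e0 _]] := h (delta_mx 0 0).
  have [[r s] [/= e1 _]] := h (delta_mx 1 0).
  have := gdet_comb a b p q r s; rewrite -e0 -e1 /gdet !mxE /= => E.
  by apply/unitrP; exists (p * s - q * r); split; [|rewrite mulrC];
    rewrite -[LHS]E; ring.
have K := mulVr h.
exists ((gdet a b)^-1 * gdet w b, (gdet a b)^-1 * gdet a w); split.
  apply: gvecP; rewrite /= !mxE /gdet; rewrite /gdet in K.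
    by rewrite -[LHS]mul1r -K; ring.
  by rewrite -[LHS]mul1r -K; ring.
move=> [p q] /= ->; rewrite gdet_combl gdet_combr.
by congr pair; rewrite mulrCA K mulr1.
Qed.

Lemma row_mx_ent (T : Type) (a b : 'cV[T]_2) (i : 'I_2) :
  ((row_mx a b : 'M_2) i 0 = a i 0) * ((row_mx a b : 'M_2) i 1 = b i 0).
Proof.
split; first by rewrite -(row_mxEl a b i 0); congr (row_mx _ _ _ _); apply: val_inj.
by rewrite -(row_mxEr a b i 0); congr (row_mx _ _ _ _); apply: val_inj.
Qed.

Lemma det_mx22 (T : comRingType) (M : 'M[T]_2) :
  \det M = M 0 0 * M 1 1 - M 0 1 * M 1 0.
Proof.
rewrite (expand_det_row _ 0) !big_ord_recl big_ord0 /cofactor !det_mx11 !mxE.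
rewrite /= addr0 expr0 expr1 mul1r mulN1r mulrN.
by congr (_ * M _ _ - M _ _ * M _ _); apply/val_inj.
Qed.

Lemma det_row_mx2 (a b : gvec) : \det (row_mx a b : 'M_2) = gdet a b.
Proof. by rewrite det_mx22 !row_mx_ent /gdet; ring. Qed.

Lemma gbasis_unitmx (a b : gvec) :
  gbasis a b <-> (row_mx a b : 'M_2) \in unitmx.
Proof. by rewrite gbasisP unitmxE det_row_mx2. Qed.

Lemma lax_refl (v : gvec) : lax v v.
Proof. by exists 1; rewrite ?unitr1 ?scale1r. Qed.

Lemma laxZ (e : gint) (v : gvec) : e \is a GRing.unit -> lax (e *: v) = lax v.
Proof.
move=> eu; apply/seteqP; split=> w [f fu ->].
  by exists (f * e); rewrite ?unitrM ?fu ?eu // scalerA.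
exists (f / e); first by rewrite unitrM fu unitrV.
by rewrite scalerA divrK.
Qed.

Lemma lax_eqP (u v : gvec) :
  lax u = lax v -> exists2 e, e \is a GRing.unit & u = e *: v.
Proof. by move=> h; have := lax_refl u; rewrite h. Qed.

Lemma lax_eq_gdet (u v : gvec) : lax u = lax v -> gdet u v = 0.
Proof. by move/lax_eqP => [e _ ->]; rewrite /gdet !mxE; ring. Qed.

Lemma gdet_primitive (a b : gvec) : gdet a b \is a GRing.unit -> primitive a.
Proof.
move=> h d [p e0] [q e1]; move: h; rewrite /gdet e0 e1.
have -> : p * d * b 1 0 - q * d * b 0 0 = (p * b 1 0 - q * b 0 0) * d by ring.
by rewrite unitrM => /andP[].
Qed.

Lemma lax_basisP (a b : gvec) :
  lax_basis (lax a) (lax b) <-> gdet a b \is a GRing.unit.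
Proof.
split=> [[_ _ h]|h]; first exact/gbasisP/h/lax_refl/lax_refl.
split.
- by exists a => //; exact: gdet_primitive h.
- by exists b => //; apply: (@gdet_primitive _ a); rewrite gdetC unitrN.
- move=> _ _ [e eu ->] [f fu ->]; apply/gbasisP.
  by rewrite gdetZl gdetZr !unitrM eu fu h.
Qed.

Lemma superbasisP (a b c : gvec) :
  superbasis (lax a) (lax b) (lax c) <->
  [/\ gdet a b \is a GRing.unit, gdet a c \is a GRing.unit
    & gdet b c \is a GRing.unit].
Proof. by split=> -[] /lax_basisP ? /lax_basisP ? /lax_basisP ?. Qed.

(** * Symmetries of the labelled tetrahedron *)

Lemma set3_rot (T : Type) (a b c : T) : [set a; b; c] = [set b; c; a].
Proof. by rewrite -setUA setUC. Qed.

Lemma set3_swap (T : Type) (a b c : T) : [set a; b; c] = [set b; a; c].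
Proof. by rewrite [[set a; b]]setUC. Qed.

Ltac set3_eq := solve [apply/seteqP; split=> ? /=; tauto].
Ltac walls_eq :=
  apply/seteqP; split=> W [[[->|->]|->]|->];
  first [left; left; left; set3_eq | left; left; right; set3_eq
        | left; right; set3_eq | right; set3_eq].

Lemma walls_rot u v w x y z : walls u v w x y z = walls v w u y z x.
Proof. walls_eq. Qed.

Lemma walls_swap u v w x y z : walls u v w x y z = walls v u w y x z.
Proof. walls_eq. Qed.

(** The rotation of the tetrahedron about the vertex with edges [u], [v], [z]. *)
Lemma walls_turn u v w x y z : walls u v w x y z = walls v z x y w u.
Proof. walls_eq. Qed.

Lemma walls_far u v w x y z : walls u v w x y z = walls y z u v w x.
Proof. walls_eq. Qed.

(** * Standard chambers and lax lattices *)

Lemma walls_tilt u v w x y z : walls u v w x y z = walls z x v w u y.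
Proof. walls_eq. Qed.

Lemma lax_by (e : gint) (u v : gvec) :
  e \is a GRing.unit -> u = e *: v -> lax u = lax v.
Proof. by move=> eu ->; exact: laxZ. Qed.

Ltac gvec_ring := apply: gvecP; rewrite !mxE; ring: gI2.
Ltac lax_scale e := by apply: (@lax_by e) => //; gvec_ring.

(** The left standard chamber of $u = a$, $v = -ib$, $w = ib - a$, with edges rescaled by units. Its
    vertex at $u, v, u + iv$ has edges $a, b, a + b$ and label $(a, b)$. *)
Definition std_walls (a b : gvec) : set wall :=
  walls (lax a) (lax b) (lax (a - gI *: b)) (lax (a + (1 - gI) *: b))
    (lax ((1 + gI) *: a + b)) (lax (a + b)).

Lemma sum0_third (u v w : gvec) : u + v + w = 0 -> w = - u - v.
Proof. by move=> h; apply: (addrI (u + v)); rewrite h; gvec_ring. Qed.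

Lemma left_walls_std (u v w : gvec) :
  u + v + w = 0 -> left_walls u v w = std_walls u (gI *: v).
Proof.
move/sum0_third => ->; rewrite /left_walls /std_walls; congr walls.
- lax_scale (- gI).
- lax_scale (-1 : gint).
- lax_scale (- gI).
- lax_scale gI.
Qed.

Lemma left_walls_rot (u v w : gvec) : left_walls u v w = left_walls v w u.
Proof. exact: walls_rot. Qed.

(** Since $u - iv = -i(v + iu)$, exchanging two vectors of the wall turns a right chamber into a
    left one, so one standard form covers both. *)
Lemma right_left_walls (u v w : gvec) : right_walls u v w = left_walls v u w.
Proof.
rewrite /left_walls /right_walls walls_swap; congr walls.
- lax_scale (- gI).
- lax_scale (- gI).
- lax_scale (- gI).
Qed.

Lemma std_walls_turn (a b : gvec) : std_walls a b = std_walls b (- a - b).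
Proof.
rewrite /std_walls walls_turn; congr walls.
- lax_scale (-1 : gint).
- lax_scale (- gI).
- lax_scale (- gI).
- lax_scale (-1 : gint).
- lax_scale (-1 : gint).
Qed.

Lemma std_walls_scale (e : gint) (a b : gvec) :
  e \is a GRing.unit -> std_walls (e *: a) (e *: b) = std_walls a b.
Proof.
move=> eu; rewrite /std_walls; congr walls;
  by apply: (lax_by eu) => //; apply: gvecP; rewrite !mxE; ring.
Qed.

(** With $u + v + w = 0$ the new pair is $i(u + iv)$, $i(v + iw)$: the vertex opposite the wall
    $\{u, v, w\}$ takes the place of the vertex at [u], [v]. *)
Lemma std_walls_tilt (u v : gvec) :
  std_walls u (gI *: v) = std_walls (gI *: u - v) (gI *: v + u + v).
Proof.
rewrite /std_walls walls_tilt; congr walls.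
- lax_scale (- gI).
- lax_scale (1 : gint).
- lax_scale (-1 : gint).
- lax_scale (1 : gint).
- lax_scale (- gI).
- lax_scale (1 : gint).
Qed.

(** * Bases modulo $SL_2(\mathbb{Z})$ and units *)

Definition lax_equiv (a b a' b' : gvec) : Prop :=
  exists (e : gint) (p q r s : int),
    [/\ e \is a GRing.unit, p * s - q * r = 1,
        a' = e *: (p%:~R *: a + q%:~R *: b)
      & b' = e *: (r%:~R *: a + s%:~R *: b)].

Lemma lax_equiv_sym (a b a' b' : gvec) :
  lax_equiv a b a' b' -> lax_equiv a' b' a b.
Proof.
move=> [e [p [q [r [s [eu d -> ->]]]]]].
(* Multiplying by this form of $1$ turns both remaining goals into polynomial identities. *)
have one : 1 = e^-1 * e * (p%:~R * s%:~R - q%:~R * r%:~R).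
  by rewrite -!intrM -intrB d mulr1 mulVr.
exists e^-1, s, (- q), (- r), p; split; first by rewrite unitrV.
- by rewrite -[RHS]d; ring.
- rewrite -[LHS]scale1r [X in X *: _ = _]one.
  by apply: gvecP; rewrite !mxE !mulrNz; ring.
- rewrite -[LHS]scale1r [X in X *: _ = _]one.
  by apply: gvecP; rewrite !mxE !mulrNz; ring.
Qed.

Lemma lax_equiv_trans (a b a' b' a'' b'' : gvec) :
  lax_equiv a b a' b' -> lax_equiv a' b' a'' b'' -> lax_equiv a b a'' b''.
Proof.
move=> [e [p [q [r [s [eu d -> ->]]]]]] [f [p' [q' [r' [s' [fu d' -> ->]]]]]].
exists (f * e), (p' * p + q' * r), (p' * q + q' * s), (r' * p + s' * r),
  (r' * q + s' * s); split.
- by rewrite unitrM fu eu.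
- transitivity ((p' * s' - q' * r') * (p * s - q * r)); first by ring.
  by rewrite d d'.
- by apply: gvecP; rewrite !mxE !intrD !intrM; ring.
- by apply: gvecP; rewrite !mxE !intrD !intrM; ring.
Qed.

Lemma lax_equiv_scale (e : gint) (a b : gvec) :
  e \is a GRing.unit -> lax_equiv a b (e *: a) (e *: b).
Proof. by move=> eu; exists e, 1, 0, 0, 1; split=> //; gvec_ring. Qed.

Lemma lax_equiv_refl (a b : gvec) : lax_equiv a b a b.
Proof. by exists 1, 1, 0, 0, 1; split=> //; gvec_ring. Qed.

Lemma lax_equiv_quarter (a b : gvec) : lax_equiv a b (- b) a.
Proof. by exists 1, 0, (-1), 1, 0; split=> //; gvec_ring. Qed.

Lemma lax_equiv_turn (a b : gvec) : lax_equiv a b b (- a - b).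
Proof. by exists 1, 0, 1, (-1), (-1); split=> //; gvec_ring. Qed.

Lemma lax_equiv_gdet (a b a' b' : gvec) : lax_equiv a b a' b' ->
  gdet a b \is a GRing.unit -> gdet a' b' \is a GRing.unit.
Proof.
move=> [e [p [q [r [s [eu d -> ->]]]]]] h.
by rewrite gdetZl gdetZr gdet_comb -!intrM -intrB d mul1r !unitrM eu h.
Qed.

(** The basis $(a', b')$ is positive for its own lattice, which is $L$ or $iL$; reading it there
    gives a matrix of determinant $1$ and the unit $1$ or $i$. *)
Lemma lax_lattice_equiv (a b a' b' : gvec) :
  lax_lattice a b = lax_lattice a' b' -> lax_equiv a b a' b'.
Proof.
move=> h; have : lax_lattice a b (olattice a' b') by rewrite h; left.
have pos : positive_bases (olattice a' b') (a', b').
  by exists 1, 0, 0, 1; split=> //=; rewrite mulr1z mulr0z ?addr0 ?add0r.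
case=> E; move: pos; rewrite E => -[p [q [r [s /= [d -> ->]]]]].
  by exists 1, p, q, r, s; rewrite !scale1r !scaler_int.
exists gI, p, q, r, s; rewrite !scaler_int.
by split=> //; rewrite scalerDr !scalerMzr.
Qed.

(** * Corners in standard form *)

Definition std_corner (c : corner) (a b : gvec) : Prop :=
  [/\ gdet a b \is a GRing.unit, chamber c = std_walls a b
    & corner_edges c = [set lax a; lax b; lax (a + b)]].

Lemma std_corner_turn (c : corner) (a b : gvec) :
  std_corner c a b -> std_corner c b (- a - b).
Proof.
move=> [h hc he]; split.
- exact: (lax_equiv_gdet (lax_equiv_turn a b)).
- by rewrite hc std_walls_turn.
- rewrite he set3_rot; congr ([set _; _; _]).
    lax_scale (-1 : gint).
  lax_scale (-1 : gint).
Qed.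

Lemma std_corner_scale (c : corner) (e : gint) (a b : gvec) :
  e \is a GRing.unit -> std_corner c a b -> std_corner c (e *: a) (e *: b).
Proof.
move=> eu [h hc he]; split.
- exact: (lax_equiv_gdet (lax_equiv_scale a b eu)).
- by rewrite std_walls_scale.
- by rewrite he -scalerDr !laxZ.
Qed.

Lemma std_corner_inj (c d : corner) (a b : gvec) :
  std_corner c a b -> std_corner d a b -> c = d.
Proof.
case: c d => [A E P] [A' E' P'] [_ /= hc he] [_ /= hc' he'].
move: P P'; rewrite hc he hc' he' => P P'.
by congr Corner; exact: Prop_irrelevance.
Qed.

(** The four vertices of a left and of a right chamber are brought to standard form by rotating the
    wall, exchanging right for left, or tilting the chamber. *)
Lemma carries_std (c : corner) (a b : gvec) : carries c a b ->
  exists a' b', std_corner c a' b' /\ lax_equiv a b a' b'.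
Proof.
move=> [u [v [w [s0 /superbasisP[d1 _ _] h]]]].
have swapE (x y z : gvec) : x + y + z = 0 -> y + x + z = 0.
  by move<-; rewrite (addrC y).
have rotE (x y z : gvec) : x + y + z = 0 -> y + z + x = 0.
  by move<-; rewrite addrC addrA.
have left_std (x y z : gvec) : x + y + z = 0 -> gdet x y \is a GRing.unit ->
    chamber c = left_walls x y z ->
    corner_edges c = [set lax x; lax y; lax (x + gI *: y)] ->
    std_corner c x (gI *: y).
  move=> s1 xy hc he; split; first by rewrite gdetZr unitrM xy.
    by rewrite hc left_walls_std.
  by rewrite he laxZ.
have d2 (x y z : gvec) : x + y + z = 0 -> gdet x y \is a GRing.unit ->
    gdet y z \is a GRing.unit.
  move/sum0_third => -> xy; suff -> : gdet y (- x - y) = gdet x y by [].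
  by rewrite /gdet !mxE; ring.
have dswap (x y : gvec) : gdet x y \is a GRing.unit ->
    gdet y x \is a GRing.unit by rewrite gdetC unitrN.
case: h => -[hc].
  case=> -[he [-> ->]].
  - exists u, (gI *: v); split; last exact: lax_equiv_refl.
    exact: left_std hc he.
  - exists v, (gI *: w); split; last exact: lax_equiv_refl.
    apply: left_std (rotE _ _ _ s0) (d2 _ _ _ s0 d1) _ he.
    by rewrite hc left_walls_rot.
  - exists w, (gI *: u); split; last exact: lax_equiv_refl.
    apply: left_std (rotE _ _ _ (rotE _ _ _ s0)) _ _ he.
      exact: (d2 _ _ _ (rotE _ _ _ s0) (d2 _ _ _ s0 d1)).
    by rewrite hc left_walls_rot left_walls_rot.
  (* At the vertex opposite the wall, [std_walls_tilt] gives the pair $(iu - v, iv - w)$, a quarter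
     turn of the label $(w - iv, iu - v)$. *)
  - have wE := sum0_third s0.
    exists (gI *: u - v), (gI *: v - w); split; last first.
      by exists 1, 0, 1, (-1), 0; split=> //; gvec_ring.
    split.
    + rewrite wE; suff -> : gdet (gI *: u - v) (gI *: v - (- u - v)) =
        gI * gdet u v by rewrite unitrM d1.
      by rewrite /gdet !mxE; ring: gI2.
    + by rewrite hc left_walls_std // std_walls_tilt wE; congr std_walls; gvec_ring.
    + rewrite he wE; congr ([set _; _; _]).
      * lax_scale (- gI).
      * lax_scale (- gI).
      * lax_scale gI.
have right_std (x y z : gvec) : x + y + z = 0 -> gdet x y \is a GRing.unit ->
    chamber c = right_walls x y z ->
    corner_edges c = [set lax x; lax y; lax (x - gI *: y)] ->
    std_corner c y (gI *: x).
  move=> s1 xy hc' he; apply: left_std (swapE _ _ _ s1) (dswap _ _ xy) _ _.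
    by rewrite hc' right_left_walls.
  rewrite he set3_swap; congr ([set _; _; _]).
  lax_scale (- gI).
(* A right vertex at [x], [y] is labelled $(x, iy)$, but its left presentation gives $(y, ix)$: they
   differ by a quarter turn and the unit $-i$. *)
have eqv (x y : gvec) : lax_equiv x (gI *: y) y (gI *: x).
  by exists (- gI), 0, 1, (-1), 0; split=> //; gvec_ring.
have rrot (x y z : gvec) : right_walls x y z = right_walls y z x.
  exact: walls_rot.
case=> -[he [-> ->]].
- exists v, (gI *: u); split => //; exact: right_std hc he.
- exists w, (gI *: v); split => //.
  apply: right_std (rotE _ _ _ s0) (d2 _ _ _ s0 d1) _ he.
  by rewrite hc rrot.
- exists u, (gI *: w); split => //.
  apply: right_std (rotE _ _ _ (rotE _ _ _ s0)) _ _ he.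
    exact: (d2 _ _ _ (rotE _ _ _ s0) (d2 _ _ _ s0 d1)).
  by rewrite hc rrot rrot.
- have wE := sum0_third s0.
  exists (w + gI *: v), (gI *: u + v); split; last exact: lax_equiv_refl.
  split.
  + rewrite wE; suff -> : gdet (- u - v + gI *: v) (gI *: u + v) =
      gI * gdet u v by rewrite unitrM d1.
    by rewrite /gdet !mxE; ring: gI2.
  + rewrite hc right_left_walls left_walls_std ?(swapE _ _ _ s0) //.
    (* The tilt and two turns lead to $i$ times the label, and scaling by $-i$ removes the
       factor. *)
    rewrite std_walls_tilt std_walls_turn std_walls_turn.
    by rewrite -(@std_walls_scale (- gI)) // wE; congr std_walls; gvec_ring.
  + rewrite he wE (set3_swap (lax (u - _))); congr ([set _; _; _]).
    * lax_scale (- gI).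
    * lax_scale (- gI).
    * lax_scale gI.
Qed.

(** * Corners and gluing *)

Lemma gdetxx (a : gvec) : gdet a a = 0.
Proof. by rewrite /gdet; ring. Qed.

Lemma std_carries (c : corner) (a b : gvec) : std_corner c a b -> carries c a b.
Proof.
move=> [h hc he]; have s0 : a + - gI *: b + (gI *: b - a) = 0 by gvec_ring.
have ib : gI *: (- gI *: b) = b by gvec_ring.
(* With $u = a$ and $v = -ib$ the label $(u, iv)$ is $(a, b)$. *)
exists a, (- gI *: b), (gI *: b - a); split=> //.
  apply/superbasisP; split.
  - by rewrite gdetZr unitrM h.
  - suff -> : gdet a (gI *: b - a) = gI * gdet a b by rewrite unitrM h.
    by rewrite /gdet !mxE; ring.
  - suff -> : gdet (- gI *: b) (gI *: b - a) = - gI * gdet a b.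
      by rewrite unitrM h.
    by rewrite /gdet !mxE; ring.
left; split; first by rewrite left_walls_std // ib.
by apply: Or41; rewrite ib laxZ.
Qed.

(** * Superbases and the chambers on a wall *)

Lemma lax_basis_sym A B : lax_basis A B -> lax_basis B A.
Proof.
move=> [hA hB h]; split=> // b a hb ha; apply/gbasisP.
by rewrite gdetC unitrN; exact/gbasisP/h.
Qed.

Lemma superbasis_rot A B C : superbasis A B C -> superbasis B C A.
Proof. by move=> [? ? ?]; split=> //; exact: lax_basis_sym. Qed.

Lemma superbasis_swap A B C : superbasis A B C -> superbasis B A C.
Proof. by move=> [? ? ?]; split=> //; exact: lax_basis_sym. Qed.

(** Up to units, the determinants of the third vector with [u] and [v] are its coordinates in the
    basis $(u, v)$, which are therefore units. *)
Lemma basis_third (u v : gvec) (Z : set gvec) : gdet u v \is a GRing.unit ->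
  lax_basis (lax u) Z -> lax_basis (lax v) Z ->
  exists e f, [/\ e \is a GRing.unit, f \is a GRing.unit
                & Z = lax (e *: u + f *: v)].
Proof.
move=> uv [_ [z _ ->] uz] [_ _ vz].
have /gbasisP h1 := uz _ _ (lax_refl u) (lax_refl z).
have /gbasisP h2 := vz _ _ (lax_refl v) (lax_refl z).
have /gbasisP /(_ z) [[e f] [/= zE _]] := uv.
move: h1 h2; rewrite zE gdet_combr unitrM => /andP[fu _].
rewrite gdetC gdet_combl unitrN unitrM => /andP[eu _].
by exists e, f.
Qed.

Lemma superbasis_sum0 A B C : superbasis A B C -> exists u v w,
  [/\ u + v + w = 0, gdet u v \is a GRing.unit
    & [/\ A = lax u, B = lax v & C = lax w]].
Proof.
move=> [AB AC BC]; have [[a _ aE] [b _ bE] _] := AB.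
move: AB AC BC; rewrite aE bE => /lax_basisP ab aC bC.
have [e [f [eu fu ->]]] := basis_third ab aC bC.
exists (e *: a), (f *: b), (- (e *: a + f *: b)); split.
- by rewrite subrr.
- by rewrite gdetZl gdetZr !unitrM eu fu.
- by rewrite !laxZ // -scaleN1r laxZ.
Qed.

(* With [det (u, v)] a unit and [z = u + e v], [y = w + f u], the determinant of
   [y] and [z] is [1 - e + f e] up to a unit. *)
Lemma unit_pairs (e f : gint) : e \is a GRing.unit -> f \is a GRing.unit ->
  e != 1 -> f != 1 -> 1 - e + f * e \is a GRing.unit ->
  e = f /\ (e = gI \/ e = - gI).
Proof.
move=> eu fu; have : e \in gint_unit by []. have : f \in gint_unit by [].
by rewrite !inE => /or4P[]/eqP -> /or4P[]/eqP ->; auto.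
Qed.

(** Up to a unit every candidate is $u + ev$ with a unit $e$, and $e = 1$ gives the class of $w = -u
    - v$. *)
Lemma third_edge (u v w : gvec) (Z : set gvec) :
  u + v + w = 0 -> gdet u v \is a GRing.unit ->
  lax_basis (lax u) Z -> lax_basis (lax v) Z -> Z <> lax w ->
  exists e, [/\ e \is a GRing.unit, e != 1 & Z = lax (u + e *: v)].
Proof.
move=> s0 uv uZ vZ; have [e [f [eu fu ->]]] := basis_third uv uZ vZ.
have E : lax (e *: u + f *: v) = lax (u + (f / e) *: v).
  apply: (lax_by eu); rewrite scalerDr scalerA mulrCA divrr // mulr1 //.
rewrite E => zw; exists (f / e); split=> //; first by rewrite unitrM fu unitrV.
apply/eqP => fe; apply: zw; rewrite fe (sum0_third s0).
by lax_scale (-1 : gint).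
Qed.

(** The edges off the wall are $z = u + ev$, $x = v + fw$, $y = w + gu$. The other walls force $e =
    f = g = \pm i$, and the sign tells left from right. *)
Lemma chamber_std u v w x y z :
  superbasis u v w -> superbasis u y z -> superbasis v x z ->
  superbasis w x y -> x <> u -> y <> v -> z <> w ->
  exists a b, [/\ gdet a b \is a GRing.unit,
    walls u v w x y z = std_walls a b
    & [set u; v; z] = [set lax a; lax b; lax (a + b)]].
Proof.
move=> /superbasis_sum0[a [b [c [s0 ab [-> -> ->]]]]].
move=> [ay az yz] [bx bz xz] [cx cy xy] xa yb zc.
have cE := sum0_third s0.
have bc : gdet b c \is a GRing.unit.
  suff -> : gdet b c = gdet a b by [].
  by rewrite cE /gdet !mxE; ring.
have ca : gdet c a \is a GRing.unit.
  suff -> : gdet c a = gdet a b by [].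
  by rewrite cE /gdet !mxE; ring.
have [e [eu e1 zE]] := third_edge s0 ab az bz zc.
have s1 : b + c + a = 0 by rewrite -[RHS]s0; gvec_ring.
have [f [fu f1 xE]] := third_edge s1 bc bx cx xa.
have s2 : c + a + b = 0 by rewrite -[RHS]s0; gvec_ring.
have [g [gu g1 yE]] := third_edge s2 ca cy ay yb.
(* The wall through [y] and [z] makes their determinant a unit; the wall through [x] and [z] is used
   next in the same way. *)
have eg : 1 - e + g * e \is a GRing.unit.
  move: yz; rewrite yE zE => /lax_basisP.
  suff -> : gdet (c + g *: a) (a + e *: b) = (1 - e + g * e) * gdet a b.
    by rewrite unitrM => /andP[].
  by rewrite cE /gdet !mxE; ring.
have ef : 1 - f + e * f \is a GRing.unit.
  move: xz; rewrite xE zE => /lax_basis_sym/lax_basisP.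
  suff -> : gdet (a + e *: b) (b + f *: c) = (1 - f + e * f) * gdet a b.
    by rewrite unitrM => /andP[].
  by rewrite cE /gdet !mxE; ring.
have [geE e2] := unit_pairs eu gu e1 g1 eg.
have [efE _] := unit_pairs fu eu f1 e1 ef.
move: zE xE yE; rewrite -geE efE => -> -> ->.
case: e2 => ->.
  exists a, (gI *: b); split; first by rewrite gdetZr unitrM ab.
    by rewrite -(left_walls_std s0).
  by rewrite laxZ.
(* For $e = -i$ the right chamber of $(a, b, c)$ is the left chamber of $(b, a, c)$. *)
have s3 : b + a + c = 0 by rewrite -[RHS]s0; gvec_ring.
exists b, (gI *: a); split; first by rewrite gdetZr gdetC mulrN unitrN unitrM ab.
  rewrite -(left_walls_std s3) -right_left_walls /right_walls.
  by rewrite !scaleNr.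
rewrite laxZ // set3_swap; congr ([set _; _; _]).
lax_scale (- gI).
Qed.

Ltac superbasis_perm := solve
  [ assumption | apply: superbasis_rot; assumption
  | apply: superbasis_swap; assumption
  | do 2 apply: superbasis_rot; assumption
  | apply/superbasis_swap/superbasis_rot; assumption
  | apply/superbasis_swap/superbasis_rot/superbasis_rot; assumption ].

Lemma uniq6_opposite (T : eqType) (u v w x y z : T) :
  uniq [:: u; v; w; x; y; z] -> [/\ x <> u, y <> v & z <> w].
Proof.
by move=> un; split=> E; move: un; rewrite E /= !inE eqxx ?orbT ?andbF.
Qed.

Lemma uniq6 (T : eqType) (u v w x y z : T) :
  u <> v -> u <> w -> u <> x -> u <> y -> u <> z ->
  v <> w -> v <> x -> v <> y -> v <> z -> w <> x ->
  w <> y -> w <> z -> x <> y -> x <> z -> y <> z ->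
  uniq [:: u; v; w; x; y; z].
Proof.
move=> *; rewrite /= !inE !negb_or.
by repeat (apply/andP; split) => //; apply/eqP.
Qed.

(** A symmetry of the tetrahedron moves the given vertex to the position [u], [v], [z] treated by
    [chamber_std]. *)
Lemma corner_std (c : corner) : exists a b, std_corner c a b.
Proof.
case: (cornerP c) => u [v [w [x [y [z [[un [s1 s2 s3 s4]] hc he]]]]]].
have [xu yv zw] := uniq6_opposite un.
suff [a [b [ab hw hE]]] : exists a b, [/\ gdet a b \is a GRing.unit,
    chamber c = std_walls a b
    & corner_edges c = [set lax a; lax b; lax (a + b)]] by exists a, b.
rewrite hc; case: he => [[[->|->]|->]|->].
- exact: chamber_std.
- by rewrite walls_rot; apply: chamber_std; by [|superbasis_perm].
- rewrite walls_rot walls_rot.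
  by apply: chamber_std; by [|superbasis_perm].
- rewrite walls_far set3_rot.
  by apply: chamber_std; by [exact/nesym|superbasis_perm].
Qed.

Lemma lax_comb_neq (a b : gvec) (p q r s : gint) :
  gdet a b \is a GRing.unit -> p * s - q * r != 0 ->
  lax (p *: a + q *: b) <> lax (r *: a + s *: b).
Proof.
move=> ab k0 /lax_eq_gdet; rewrite gdet_comb => /(congr1 (fun x => x / gdet a b)).
by rewrite mulrK // mul0r; exact/eqP.
Qed.

Lemma superbasis_comb (a b : gvec) (p q r s t k : gint) :
  gdet a b \is a GRing.unit ->
  [&& p * s - q * r \is a GRing.unit, p * k - q * t \is a GRing.unit
    & r * k - s * t \is a GRing.unit] ->
  superbasis (lax (p *: a + q *: b)) (lax (r *: a + s *: b))
    (lax (t *: a + k *: b)).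
Proof.
move=> ab /and3P[h1 h2 h3]; apply/superbasisP.
by rewrite !gdet_comb !unitrM h1 h2 h3.
Qed.

Lemma std_comb (a b : gvec) :
  [/\ a = 1 *: a + 0 *: b, b = 0 *: a + 1 *: b,
      a - gI *: b = 1 *: a + (- gI) *: b,
      a + (1 - gI) *: b = 1 *: a + (1 - gI) *: b
    & (1 + gI) *: a + b = (1 + gI) *: a + 1 *: b /\
      a + b = 1 *: a + 1 *: b].
Proof. by rewrite !scale1r !scale0r addr0 add0r scaleNr. Qed.

Lemma std_ultrabasis (a b : gvec) : gdet a b \is a GRing.unit ->
  ultrabasis (lax a) (lax b) (lax (a - gI *: b)) (lax (a + (1 - gI) *: b))
    (lax ((1 + gI) *: a + b)) (lax (a + b)).
Proof.
move=> ab; have [aE bE wE xE [yE zE]] := std_comb a b.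
(* In coordinates over $(a, b)$ all determinants are explicit Gaussian integers, so distinctness and
   unit conditions follow by computation. *)
suff : ultrabasis (lax (1 *: a + 0 *: b)) (lax (0 *: a + 1 *: b))
    (lax (1 *: a + (- gI) *: b)) (lax (1 *: a + (1 - gI) *: b))
    (lax ((1 + gI) *: a + 1 *: b)) (lax (1 *: a + 1 *: b)).
  by rewrite -wE -xE -yE -zE -aE -bE.
split; first by apply: uniq6; apply: lax_comb_neq.
by split; apply: superbasis_comb.
Qed.

Lemma std_corner_exists (a b : gvec) :
  gdet a b \is a GRing.unit -> exists c, std_corner c a b.
Proof.
move=> ab; have P : exists u v w x y z : set gvec,
    [/\ ultrabasis u v w x y z, std_walls a b = walls u v w x y z
      & corners u v w x y z [set lax a; lax b; lax (a + b)]].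
  do 6 eexists; split; first exact: std_ultrabasis ab; first by [].
  by left; left; left.
by exists (Corner P).
Qed.

(** * Gluing and equivalence of pairs *)

Lemma std_wall_edges (a b : gvec) : gdet a b \is a GRing.unit ->
  [set lax a; lax b; lax (a + b)] `&` [set lax a; lax b; lax (a - gI *: b)] =
  [set lax a; lax b].
Proof.
move=> ab; have [aE bE wE xE [yE zE]] := std_comb a b.
apply/seteqP; split=> L /=; last by case=> ->; split; auto.
case=> -[[->|->]|->]; auto.
by case=> // ; rewrite wE zE => /lax_comb_neq; case.
Qed.

Lemma std_far_wall (a b : gvec) (L : set gvec) : gdet a b \is a GRing.unit ->
  [set lax a; lax b; lax (a + b)] L ->
  ~ [set lax (a - gI *: b); lax (a + (1 - gI) *: b); lax ((1 + gI) *: a + b)] L.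
Proof.
move=> ab; have [aE bE wE xE [yE zE]] := std_comb a b.
have E1 : lax a = lax (1 *: a + 0 *: b) by rewrite -aE.
have E2 : lax b = lax (0 *: a + 1 *: b) by rewrite -bE.
rewrite wE xE yE zE E1 E2 /=.
by case=> [[->|->]|->] [[|]|]; apply: lax_comb_neq.
Qed.

Lemma walls_std_first (a b : gvec) :
  std_walls a b [set lax a; lax b; lax (a - gI *: b)].
Proof. by left; left; left. Qed.

(** As $a - ib = i(-b - ia)$, both pairs have the same first wall, and both corners meet it in the
    edges [a], [b]. *)
Lemma std_corner_glued (c d : corner) (a b : gvec) :
  std_corner c a b -> std_corner d (- b) a -> glued c d.
Proof.
move=> [ab cc ce] [ba dc de].
have WE : [set lax a; lax b; lax (a - gI *: b)] =
    [set lax (- b); lax a; lax (- b - gI *: a)].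
  rewrite set3_swap; congr ([set _; _; _]).
    lax_scale (-1 : gint).
  lax_scale gI.
exists [set lax a; lax b; lax (a - gI *: b)]; split.
- by rewrite cc; exact: walls_std_first.
- by rewrite dc WE; exact: walls_std_first.
- by exists (lax a); rewrite ce; split; left; left.
- rewrite ce std_wall_edges // WE de std_wall_edges // setUC; congr ([set _; _]).
  lax_scale (-1 : gint).
Qed.

(** Turning permutes the three walls at the vertex and the fourth contains none of its edges, so any
    gluing can be taken along the first wall of a suitable pair. *)
Lemma std_corner_wall (c : corner) (a b : gvec) (W : wall) :
  std_corner c a b -> chamber c W -> corner_edges c `&` W !=set0 ->
  exists a' b', [/\ std_corner c a' b', lax_equiv a b a' b',
    W = [set lax a'; lax b'; lax (a' - gI *: b')]
    & corner_edges c `&` W = [set lax a'; lax b']].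
Proof.
move=> h cW EW.
have first_wall a' b' : std_corner c a' b' -> lax_equiv a b a' b' ->
    W = [set lax a'; lax b'; lax (a' - gI *: b')] ->
    exists a' b', [/\ std_corner c a' b', lax_equiv a b a' b',
    W = [set lax a'; lax b'; lax (a' - gI *: b')]
    & corner_edges c `&` W = [set lax a'; lax b']].
  move=> h' e wE; exists a', b'; split=> //.
  by case: h' => [ab _ ->]; rewrite wE std_wall_edges.
have t1 := std_corner_turn h; have e1 := lax_equiv_turn a b.
have t2 := std_corner_turn t1.
have e2 := lax_equiv_trans e1 (lax_equiv_turn b (- a - b)).
case: (h) => [ab hc hE]; move: cW; rewrite hc => -[[[wE|wE]|wE]|wE].
- exact: first_wall h (lax_equiv_refl a b) wE.
- apply: first_wall t2 e2 _; rewrite wE set3_rot set3_rot.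
  congr ([set _; _; _]).
  + lax_scale (-1 : gint).
  + lax_scale (1 : gint).
  + lax_scale (-1 : gint).
- apply: first_wall t1 e1 _; rewrite wE set3_swap set3_rot.
  congr ([set _; _; _]).
  + lax_scale (-1 : gint).
  + lax_scale (- gI).
- case: EW => L; rewrite hE wE => -[EL] /(std_far_wall ab EL) //.
Qed.

(** Once both pairs have the common wall as first wall, [a2] and [b2] are unit multiples of [a1] and
    [b1] in some order; the third edge of the wall relates the two units. *)
Lemma glued_equiv (c d : corner) (a b a' b' : gvec) :
  std_corner c a b -> std_corner d a' b' -> glued c d -> lax_equiv a b a' b'.
Proof.
move=> hc hd [W [cW dW cE cd]].
have dE : corner_edges d `&` W !=set0 by rewrite -cd.
have [a1 [b1 [[ab _ _] e1 W1 E1]]] := std_corner_wall hc cW cE.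
have [a2 [b2 [[ab' _ _] e2 W2 E2]]] := std_corner_wall hd dW dE.
suff : lax_equiv a1 b1 a2 b2.
  by move/(lax_equiv_trans e1)/lax_equiv_trans; apply; exact: lax_equiv_sym.
have Ia : [set lax a1; lax b1] (lax a2) by rewrite -E1 cd E2; left.
have Ib : [set lax a1; lax b1] (lax b2) by rewrite -E1 cd E2; right.
have Iw : [set lax a1; lax b1; lax (a1 - gI *: b1)] (lax (a2 - gI *: b2)).
  by rewrite -W1 W2; right.
have k0 (k : gint) : k \is a GRing.unit -> k * gdet a1 b1 <> 0.
  move=> ku k0; have : k * gdet a1 b1 \is a GRing.unit by rewrite unitrM ku.
  by rewrite k0 unitr0.
have coef (k l k' l' : gint) :
    k *: a1 + l *: b1 = k' *: a1 + l' *: b1 -> k = k' /\ l = l'.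
  move=> E; split.
    by have := congr1 (gdet^~ b1) E; rewrite !gdet_combl => /(mulIr ab).
  by have := congr1 (gdet a1) E; rewrite !gdet_combr => /(mulIr ab).
case: Ia Ib => [/lax_eqP[e eu aE]|/lax_eqP[e eu aE]]
  [/lax_eqP[f fu bE]|/lax_eqP[f fu bE]]; rewrite {}aE {}bE in ab' Iw *.
- by move: ab'; rewrite gdetZl gdetZr gdetxx !mulr0 unitr0.
(* Same order: the third edge can only match $a_1 - ib_1$, which forces $e = f$, a common
   scaling. *)
- case: Iw => [[/lax_eq_gdet E|/lax_eq_gdet E]|/lax_eqP[k ku E]].
  + case: (k0 (gI * f)); first by rewrite unitrM fu.
    by rewrite -[RHS]E /gdet !mxE; ring.
  + by case: (k0 _ eu); rewrite -[RHS]E /gdet !mxE; ring.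
  + have [ek fk] : e = k /\ - gI * f = - gI * k.
      apply: coef; transitivity (e *: a1 - gI *: (f *: b1)); first by gvec_ring.
      by rewrite E; gvec_ring.
    have {}fk : f = k by apply: (@mulrI _ (- gI)).
    by rewrite ek fk; exact: lax_equiv_scale.
(* Exchanged order: the third edge forces $e = -f$, a quarter turn up to a unit. *)
- case: Iw => [[/lax_eq_gdet E|/lax_eq_gdet E]|/lax_eqP[k ku E]].
  + by case: (k0 _ eu); apply: oppr_inj; rewrite oppr0 -[RHS]E /gdet !mxE; ring.
  + case: (k0 (- gI * f)); first by rewrite unitrM fu.
    by rewrite -[RHS]E /gdet !mxE; ring.
  + have [fk ek] : - gI * f = k /\ e = - gI * k.
      apply: coef; transitivity (e *: b1 - gI *: (f *: a1)); first by gvec_ring.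
      by rewrite E; gvec_ring.
    exists e, 0, 1, (-1), 0; split=> //; first by gvec_ring.
    rewrite ek -fk; gvec_ring.
- by move: ab'; rewrite gdetZl gdetZr gdetxx !mulr0 unitr0.
Qed.

(** Both pairs are compared with a neighbour: a corner with pair $(-b, a)$ is glued to [c] whichever
    pair describes [c], so [glued_equiv] applies to $(a', b')$ too. *)
Lemma std_corner_equiv (c : corner) (a b a' b' : gvec) :
  std_corner c a b -> std_corner c a' b' -> lax_equiv a b a' b'.
Proof.
move=> h h'; have e := lax_equiv_quarter a b.
have [d hd] : exists d, std_corner d (- b) a.
  by apply: std_corner_exists; apply: lax_equiv_gdet e _; case: h.
apply: lax_equiv_trans e _; apply: lax_equiv_sym.
exact: glued_equiv h' hd (std_corner_glued h hd).
Qed.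

Lemma glue_class_equiv (c d : corner) (a b a' b' : gvec) :
  std_corner c a b -> std_corner d a' b' ->
  clos_refl_sym_trans corner glued c d -> lax_equiv a b a' b'.
Proof.
move=> hc hd h; elim: h a b a' b' hc hd => {c d}.
- by move=> c d g a b a' b' hc hd; exact: glued_equiv hc hd g.
- by move=> c a b a' b'; exact: std_corner_equiv.
- by move=> c d _ IH a b a' b' hc hd; apply: lax_equiv_sym; exact: IH.
- move=> c d f _ IH1 _ IH2 a b a' b' hc hf.
  have [a1 [b1 hd]] := corner_std d.
  exact: lax_equiv_trans (IH1 _ _ _ _ hc hd) (IH2 _ _ _ _ hd hf).
Qed.

(* Euclid's algorithm on the first column. *)
Lemma SL2Z_ind (P : int -> int -> int -> int -> Prop) :
  P 1 0 0 1 ->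
  (forall p q r s, P p q r s -> P (- r) (- s) p q) ->
  (forall p q r s, P p q r s -> P r s (- p - r) (- q - s)) ->
  forall p q r s : int, p * s - q * r = 1 -> P p q r s.
Proof.
move=> P1 PS PT.
(* The two moves are first combined into negation and the elementary row operations: [PU] and [PD]
   act on the second row, [PV] and [PW] on the first. *)
have PN p q r s : P p q r s -> P (- p) (- q) (- r) (- s).
  by move=> /PS /PS.
have PU p q r s : P p q r s -> P p q (r - p) (s - q).
  by move=> /PS /PT; rewrite !opprK.
have PD p q r s : P p q r s -> P p q (r + p) (s + q).
  move=> /PT /PT /PS /PN.
  have -> : - - (- r - (- p - r)) = p by lia.
  have -> : - - (- s - (- q - s)) = q by lia.
  have -> : - (- p - r) = r + p by lia.
  by have -> : - (- q - s) = s + q by lia.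
(* Base case of a zero first entry: determinant $1$ leaves $q = \pm 1$, and row operations lower
   $|s|$ to $0$. *)
have P0 (n : nat) (q s : int) : q = 1 \/ q = -1 -> (`|s| <= n)%N ->
    P 0 q (- q) s.
  elim: n q s => [|n IH] q s hq hs.
    have -> : s = 0 by lia.
    by case: hq => ->; [exact: (PN _ _ _ _ (PS _ _ _ _ P1)) |
      exact: (PS _ _ _ _ P1)].
  have [s0|s0] := eqVneq s 0; first by apply: IH => //; rewrite s0.
  have [sq|sq] := leP 0 (s * q).
    have h : P 0 q (- q) (s - q) by apply: IH => //; case: hq sq => -> ; lia.
    by have := PD _ _ _ _ h; rewrite addr0 subrK.
  have h : P 0 q (- q) (s + q) by apply: IH => //; case: hq sq => -> ; lia.
  by have := PU _ _ _ _ h; rewrite subr0 addrK.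
have PV p q r s : P p q r s -> P (p - r) (q - s) r s.
  move=> /PS /PD /PS /PS /PS.
  by rewrite !opprK.
have PW p q r s : P p q r s -> P (p + r) (q + s) r s.
  move=> /PS /PU /PS /PS /PS.
  by rewrite !opprK.
suff H (n : nat) (p q r s : int) : (`|p| + `|r| <= n)%N ->
    p * s - q * r = 1 -> P p q r s.
  by move=> p q r s; exact: (H _ _ _ _ _ (leqnn _)).
elim: n p q r s => [|n IH] p q r s.
  move=> le0 d; have p0 : p = 0 by lia. have r0 : r = 0 by lia.
  by move: d; rewrite p0 r0 mul0r mulr0.
have unit_pm (x y : int) : x * y = 1 -> x = 1 /\ y = 1 \/ x = -1 /\ y = -1.
  move=> xy; have x0 : x != 0 by apply: contra_eq_neq xy => ->; rewrite mul0r.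
  have y0 : y != 0 by apply: contra_eq_neq xy => ->; rewrite mulr0.
  nia.
move=> le d; have [p0|p0] := eqVneq p 0.
  move: d; rewrite p0 mul0r sub0r -mulrN => /unit_pm h.
  have -> : r = - q by lia.
  by apply: (P0 _ _ _ _ (leqnn _)); lia.
have [r0|r0] := eqVneq r 0.
  move: d; rewrite r0 mulr0 subr0 => /unit_pm h.
  have /PS : P 0 s (- s) (- q) by apply: (P0 _ _ _ _ (leqnn _)); lia.
  have -> : p = s by lia.
  by rewrite !opprK.
(* The sign of $pr$ decides between subtracting and adding; the row whose first entry is larger in
   absolute value is reduced. *)
have [pr|pr] := leP 0 (p * r); have [lpr|lpr] := leqP `|p| `|r|.
- have h : P p q (r - p) (s - q) by apply: IH; [nia | rewrite -[RHS]d; ring].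
  by have := PD _ _ _ _ h; rewrite !subrK.
- have h : P (p - r) (q - s) r s by apply: IH; [nia | rewrite -[RHS]d; ring].
  by have := PW _ _ _ _ h; rewrite !subrK.
- have h : P p q (r + p) (s + q) by apply: IH; [nia | rewrite -[RHS]d; ring].
  by have := PU _ _ _ _ h; rewrite !addrK.
- have h : P (p + r) (q + s) r s by apply: IH; [nia | rewrite -[RHS]d; ring].
  by have := PV _ _ _ _ h; rewrite !addrK.
Qed.

(** The unit is absorbed without changing the corner. Then [SL2Z_ind] decomposes the matrix: a
    quarter turn is a gluing, and a turn keeps the corner. *)
Lemma equiv_glue_class (c d : corner) (a b a' b' : gvec) :
  std_corner c a b -> std_corner d a' b' -> lax_equiv a b a' b' ->
  clos_refl_sym_trans corner glued c d.
Proof.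
move=> hc hd [e [p [q [r [s [eu det aE bE]]]]]].
have {hd} : std_corner d (p%:~R *: a + q%:~R *: b) (r%:~R *: a + s%:~R *: b).
  have ev : e^-1 \is a GRing.unit by rewrite unitrV.
  by have := std_corner_scale ev hd; rewrite aE bE !scalerA mulVr // !scale1r.
move: p q r s det {aE bE a' b'} d; apply: SL2Z_ind => [d|p q r s IH d|p q r s IH d].
- rewrite !mulr1z !mulr0z !scale1r !scale0r addr0 add0r => hd.
  by rewrite (std_corner_inj hc hd); exact: rst_refl.
- set x := p%:~R *: a + q%:~R *: b in IH *.
  set y := r%:~R *: a + s%:~R *: b in IH *.
  have -> : (- r)%:~R *: a + (- s)%:~R *: b = - y.
    by rewrite !mulrNz !scaleNr -opprD.
  move=> hd; have [f hf] : exists f, std_corner f x y.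
    apply: std_corner_exists.
    by apply: lax_equiv_gdet (lax_equiv_sym (lax_equiv_quarter x y)) _; case: hd.
  apply: rst_trans (IH _ hf) _; apply: rst_step.
  exact: std_corner_glued hf hd.
- set x := p%:~R *: a + q%:~R *: b in IH *.
  set y := r%:~R *: a + s%:~R *: b in IH *.
  have -> : (- p - r)%:~R *: a + (- q - s)%:~R *: b = - x - y.
    by rewrite /x /y; apply: gvecP; rewrite !mxE !intrD !mulrNz; ring.
  (* The turn has order three, so two more turns lead from $(y, -x - y)$ back to $(x, y)$. *)
  move=> /std_corner_turn /std_corner_turn.
  have -> : - y - (- x - y) = x by gvec_ring.
  have -> : - (- x - y) - x = y by gvec_ring.
  exact: IH.
Qed.

(** * Oriented circles *)

Lemma gint_to_C_is_zmod (R : realType) : zmod_morphism (@gint_to_C R).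
Proof.
by move=> x y; apply/eqP; rewrite eq_complex /= !intrD !mulrNz !eqxx.
Qed.

Lemma gint_to_C_is_monoid (R : realType) : monoid_morphism (@gint_to_C R).
Proof.
split=> [|x y]; first by apply/eqP; rewrite eq_complex /= !eqxx.
by apply/eqP; rewrite eq_complex /= !intrD !mulrNz !intrM !eqxx.
Qed.

HB.instance Definition _ (R : realType) := GRing.isZmodMorphism.Build gint R[i]
  (@gint_to_C R) (@gint_to_C_is_zmod R).
HB.instance Definition _ (R : realType) := GRing.isMonoidMorphism.Build gint R[i]
  (@gint_to_C R) (@gint_to_C_is_monoid R).

(** * Homogeneous coordinates and cyclic order *)

Definition hlift (F : fieldType) (x : option F) : F * F :=
  if x is Some t then (t, 1) else (1, 0).

Definition hproj (F : fieldType) (n d : F) : option F :=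
  if d == 0 then None else Some (n / d).

Definition hdet (F : fieldType) (X Y : F * F) : F := X.1 * Y.2 - X.2 * Y.1.

Lemma hproj_scale (F : fieldType) (k n d : F) :
  k != 0 -> hproj (k * n) (k * d) = hproj n d.
Proof.
move=> k0; rewrite /hproj mulf_eq0 (negbTE k0) /=.
by case: eqP => // _; rewrite -mulf_div divff // mul1r.
Qed.

Lemma hproj_eq (F : fieldType) (n d n' d' : F) :
  hproj n d = hproj n' d' -> n * d' = n' * d.
Proof.
rewrite /hproj; case: eqP => [->|/eqP d0]; case: eqP => [->|/eqP d0'] //.
  by rewrite !mulr0.
by case=> /eqP; rewrite eqr_div // => /eqP.
Qed.

Lemma hlift_proj (F : fieldType) (n d : F) : (n != 0) || (d != 0) ->
  exists k, [/\ k != 0, n = k * (hlift (hproj n d)).1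
             & d = k * (hlift (hproj n d)).2].
Proof.
rewrite /hproj; have [->|d0] := eqVneq d 0 => /=.
  by rewrite orbF => n0; exists n; rewrite mulr1 mulr0.
by move=> _; exists d; rewrite mulr1 mulrCA divff // mulr1.
Qed.

Lemma hlift_line (R : realType) (x : option R) (al be : R[i]) :
  al * (hlift x).2%:C = be * (hlift x).1%:C ->
  exists l, al = l * (hlift x).1%:C /\ be = l * (hlift x).2%:C.
Proof.
case: x => [t|] /=.
  by rewrite mulr1 => ->; exists be; rewrite mulr1.
by rewrite mulr0 mulr1 => <-; exists al; rewrite mulr1 mulr0.
Qed.

(** Determinants of lifts replace differences and include infinity. Each point occurs in two
    factors, so the sign is independent of the lifts and is kept by real maps of positive
    determinant. *)
Lemma cyclic_ltE (R : realType) (x y z : option R) :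
  cyclic_lt x y z = (0 < hdet (hlift x) (hlift y) * hdet (hlift y) (hlift z) *
    hdet (hlift z) (hlift x)).
Proof.
case: x y z => [a|] [b|] [c|]; rewrite /cyclic_lt /hdet /= ?mulr0 ?mul0r ?mulr1
  ?mul1r ?subrr ?mulr0 ?mul0r ?subr0 ?sub0r ?mulr1 ?mulN1r ?mulrN1 ?ltxx
  ?andbF ?orbF ?andbT ?orFb ?mul1r ?opprB ?subr_gt0 //.
apply/idP/idP => [/or3P[] /andP[h1 h2]|h].
- have h3 := lt_trans h1 h2.
  by rewrite pmulr_lgt0 ?subr_gt0 // nmulr_lgt0 ?subr_lt0.
- have h3 := lt_trans h1 h2.
  by rewrite nmulr_lgt0 ?subr_lt0 // nmulr_llt0 ?subr_lt0 ?subr_gt0.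
- have h3 := lt_trans h1 h2.
  by rewrite nmulr_lgt0 ?subr_lt0 // pmulr_llt0 ?subr_lt0 ?subr_gt0.
(* Three finite points in the opposite cyclic order give a negative product. *)
have neg (t u v : R) : t < u -> u < v -> 0 < (t - v) * (v - u) * (u - t) -> False.
  move=> tu uv; have tv := lt_trans tu uv.
  have : 0 < (v - t) * (v - u) * (u - t) by rewrite !mulr_gt0 ?subr_gt0.
  lra.
move: h; case: (ltgtP a b) => [ab|ab|->]; last by rewrite subrr !mul0r ltxx.
  case: (ltgtP b c) => [bc|bc|->] //=; last by rewrite subrr mulr0 mul0r ltxx.
  case: (ltgtP c a) => [ca|ca|->] //=; last by rewrite subrr mulr0 ltxx.
  by move/(neg _ _ _ ca bc).
case: (ltgtP b c) => [bc|bc|->] //=; last by rewrite subrr mulr0 mul0r ltxx.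
  case: (ltgtP c a) => [ca|ca|->] //=; last by rewrite subrr mulr0 ltxx.
  by move=> h; case: (neg _ _ _ ab ca); rewrite mulrC mulrA.
by move=> h; case: (neg _ _ _ bc ab); rewrite mulrC mulrA mulrC mulrA.
Qed.

Definition gpoint (R : realType) (a b : gvec) (x : option R) : sphere R :=
  mobius (map_mx (@gint_to_C R) (row_mx a b : 'M_2)) (real_point x).

Lemma gpointE (R : realType) (a b : gvec) (x : option R) : gpoint a b x =
  hproj (gint_to_C R (a 0 0) * (hlift x).1%:C + gint_to_C R (b 0 0) * (hlift x).2%:C)
        (gint_to_C R (a 1 0) * (hlift x).1%:C + gint_to_C R (b 1 0) * (hlift x).2%:C).
Proof.
rewrite /gpoint /mobius.
have E i j : map_mx (@gint_to_C R) (row_mx a b : 'M_2) i j =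
  gint_to_C R ((row_mx a b : 'M_2) i j) by rewrite mxE.
rewrite !E !row_mx_ent; case: x => [t|] /=; first by rewrite !mulr1.
by rewrite !mulr1 !mulr0 !addr0.
Qed.

(** [G] is the real projective map of the transposed matrix, because $x_1a' + x_2b' = e((px_1 +
    rx_2)a + (qx_1 + sx_2)b)$; determinant $1$ preserves the cyclic order. *)
Lemma lax_equiv_gpoint (R : realType) (a b a' b' : gvec) :
  lax_equiv a b a' b' -> exists G : option R -> option R,
    (forall x, gpoint a' b' x = gpoint a b (G x)) /\
    (forall x y z, cyclic_lt x y z -> cyclic_lt (G x) (G y) (G z)).
Proof.
move=> [e [p [q [r [s [eu d -> ->]]]]]].
pose n (x : option R) := p%:~R * (hlift x).1 + r%:~R * (hlift x).2.
pose m (x : option R) := q%:~R * (hlift x).1 + s%:~R * (hlift x).2.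
have d' : p%:~R * s%:~R - q%:~R * r%:~R = 1 :> R.
  by rewrite -!intrM -intrB d.
have nm x : (n x != 0) || (m x != 0).
  rewrite -negb_and; apply/negP => /andP[/eqP n0 /eqP m0].
  have : (hlift x).1 = s%:~R * n x - r%:~R * m x.
    by rewrite -[LHS]mul1r -[X in X * _ = _]d' /n /m; ring.
  have : (hlift x).2 = p%:~R * m x - q%:~R * n x.
    by rewrite -[LHS]mul1r -[X in X * _ = _]d' /n /m; ring.
  rewrite n0 m0 !mulr0 subrr; case: x {n0 m0} => [t|] /= => [/eqP|_ /eqP].
    by rewrite oner_eq0.
  by rewrite oner_eq0.
exists (fun x => hproj (n x) (m x)); split=> [x|x y z].
  have [k [k0 nE mE]] := hlift_proj (nm x).
  rewrite !gpointE; set X := hlift (hproj _ _) in nE mE *.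
  have e0 : gint_to_C R e != 0.
    by rewrite -unitfE rmorph_unit.
  have kC : k%:C != 0 by rewrite fmorph_eq0.
  rewrite -[RHS](hproj_scale _ _ (mulf_neq0 e0 kC)).
  have nC : p%:~R * (hlift x).1%:C + r%:~R * (hlift x).2%:C = k%:C * X.1%:C.
    by rewrite -rmorphM -nE /n rmorphD !rmorphM !rmorph_int.
  have mC : q%:~R * (hlift x).1%:C + s%:~R * (hlift x).2%:C = k%:C * X.2%:C.
    by rewrite -rmorphM -mE /m rmorphD !rmorphM !rmorph_int.
  have cE (i : 'I_2) : gint_to_C R e * k%:C *
      (gint_to_C R (a i 0) * X.1%:C + gint_to_C R (b i 0) * X.2%:C) =
      gint_to_C R e * (gint_to_C R (a i 0) * (k%:C * X.1%:C) +
                       gint_to_C R (b i 0) * (k%:C * X.2%:C)) by ring.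
  rewrite !cE -nC -mC !mxE !rmorphM !rmorphD !rmorphM !rmorph_int.
  by congr hproj; ring.
rewrite !cyclic_ltE.
have [k [k0 nkE mkE]] := hlift_proj (nm x).
have [l [l0 nlE mlE]] := hlift_proj (nm y).
have [h [h0 nhE mhE]] := hlift_proj (nm z).
move: nkE mkE nlE mlE nhE mhE.
set X := hlift (hproj _ _); set Y := hlift (hproj _ _).
set Z := hlift (hproj _ _) => nkE mkE nlE mlE nhE mhE.
have dE (u v : option R) : hdet (hlift u) (hlift v) = n u * m v - m u * n v.
  by rewrite -[LHS]mul1r -[X in X * _ = _]d' /hdet /n /m; ring.
rewrite (dE x y) (dE y z) (dE z x) nkE mkE nlE mlE nhE mhE.
(* Rescaling the lifts of the three images contributes only a square. *)
have -> : (k * X.1 * (l * Y.2) - k * X.2 * (l * Y.1)) *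
    (l * Y.1 * (h * Z.2) - l * Y.2 * (h * Z.1)) *
    (h * Z.1 * (k * X.2) - h * Z.2 * (k * X.1)) =
    (k * l * h) ^+ 2 * (hdet X Y * hdet Y Z * hdet Z X).
  by rewrite /hdet; ring.
have k2 : 0 < (k * l * h) ^+ 2 by rewrite exprn_even_gt0 //= !mulf_neq0.
by rewrite pmulr_rgt0.
Qed.

Lemma gaussian_image_carrier (R : realType) (a b : gvec) :
  carrier (gaussian_image R (row_mx a b)) = range (@gpoint R a b).
Proof.
apply/seteqP; split=> z /=.
  by case=> _ [x _ <-] <-; exists x.
by case=> x _ <-; exists (real_point x) => //; exists x.
Qed.

Lemma gaussian_image_triples (R : realType) (a b : gvec) :
  positive_triples (gaussian_image R (row_mx a b)) =
  [set t | exists x y z : option R, cyclic_lt x y z /\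
     t = (gpoint a b x, gpoint a b y, gpoint a b z)].
Proof.
apply/seteqP; split=> t /=.
  by case=> _ [x [y [z [xyz ->]]]] <-; exists x, y, z.
case=> x [y [z [xyz ->]]].
by exists (real_point x, real_point y, real_point z) => //; exists x, y, z.
Qed.

Lemma oriented_curve_eq (R : realType) (o o' : oriented_curve R) :
  carrier o = carrier o' -> positive_triples o = positive_triples o' -> o = o'.
Proof. by case: o o' => [c t] [c' t'] /= -> ->. Qed.

Lemma lax_equiv_image (R : realType) (a b a' b' : gvec) :
  lax_equiv a b a' b' ->
  gaussian_image R (row_mx a b) = gaussian_image R (row_mx a' b').
Proof.
move=> e; have [G [GE Gc]] := lax_equiv_gpoint R e.
have [H [HE Hc]] := lax_equiv_gpoint R (lax_equiv_sym e).
apply: oriented_curve_eq.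
  rewrite !gaussian_image_carrier; apply/seteqP; split=> _ [x _ <-].
    by exists (H x).
  by exists (G x).
rewrite !gaussian_image_triples.
apply/seteqP; split=> _ [x [y [z [xyz ->]]]].
  by exists (H x), (H y), (H z); rewrite -!HE; split=> //; exact: Hc.
by exists (G x), (G y), (G z); rewrite -!GE; split=> //; exact: Gc.
Qed.

(* An entry [x + i y] on the real line through [l] satisfies
   [(x + i y)^2 d = k t^2] where [k = l^2 d] is the unit determinant, and this
   pins down the line: it is an axis or a diagonal. *)
Lemma gint_on_line (R : realType) (k : gint) (x y : int) (l : R[i]) (t d : R) :
  0 < d -> gint_to_C R k = l ^+ 2 * d%:C ->
  gint_to_C R (GInt x y) = l * t%:C ->
  [/\ k = 1 -> y = 0, k = -1 -> x = 0, k = gI -> x = y & k = - gI -> x = - y].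
Proof.
move=> d0 kE zE.
have E : gint_to_C R (GInt x y) ^+ 2 * d%:C = gint_to_C R k * (t ^+ 2)%:C.
  by rewrite zE kE rmorphXn; ring.
have t2 : 0 <= t ^+ 2 by exact: sqr_ge0.
move: (t ^+ 2) t2 E => u u0 {zE kE t l}.
rewrite expr2 /gint_to_C; set X : R := x%:~R; set Y : R := y%:~R.
case=> e1 e2.
have {}e1 : (X * X - Y * Y) * d = (gre k)%:~R * u.
  by transitivity ((X * X - Y * Y) * d - (X * Y + Y * X) * 0); [ring|rewrite e1; ring].
have {}e2 : 2 * (X * Y) * d = (gim k)%:~R * u.
  by transitivity ((X * X - Y * Y) * 0 + (X * Y + Y * X) * d); [ring|rewrite e2; ring].
have XY0 : X * Y * d = 0 -> X * Y = 0.
  by move/eqP; rewrite mulf_eq0 (gt_eqF d0) orbF => /eqP.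
have XYd : (X * X - Y * Y) * d = 0 -> (X - Y) * (X + Y) = 0.
  move/eqP; rewrite mulf_eq0 (gt_eqF d0) orbF => /eqP h; rewrite -[RHS]h; ring.
(* For $k = \pm 1$ the product $XY$ vanishes and the sign of $X^2 - Y^2$ shows which factor is zero;
   for $k = \pm i$ one has $X^2 = Y^2$ and the sign of $XY$ selects the diagonal. *)
split=> kE; rewrite kE /= in e1 e2; apply/eqP; rewrite -(eqr_int R) -/X -/Y.
- have : X * Y = 0 by apply: XY0; lra.
  have : 0 <= X * X - Y * Y by rewrite -(pmulr_lge0 _ d0) e1 mul1r.
  move=> h /eqP; rewrite mulf_eq0 => /orP[/eqP x0|//].
  rewrite x0 mulr0 sub0r oppr_ge0 in h; rewrite -sqrf_eq0 eq_le sqr_ge0 andbT; exact: h.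
- have : X * Y = 0 by apply: XY0; lra.
  have : X * X - Y * Y <= 0 by rewrite -(pmulr_lle0 _ d0) e1; lra.
  move=> h /eqP; rewrite mulf_eq0 => /orP[//|/eqP y0].
  rewrite y0 mulr0 subr0 in h; rewrite -sqrf_eq0 eq_le sqr_ge0 andbT; exact: h.
- have : (X - Y) * (X + Y) = 0 by apply: XYd; rewrite e1 mul0r.
  have : 0 <= X * Y by rewrite -(pmulr_lge0 _ d0); lra.
  move=> h /eqP; rewrite mulf_eq0 subr_eq0 => /orP[//|]; rewrite addr_eq0 => /eqP xy.
  have y0 : Y = 0.
    move: h; rewrite xy mulNr oppr_ge0 => h; apply/eqP.
    by rewrite -sqrf_eq0 eq_le sqr_ge0 andbT; exact: h.
  by rewrite xy y0 oppr0.
- have : (X - Y) * (X + Y) = 0 by apply: XYd; rewrite e1 mul0r.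
  have : X * Y <= 0 by rewrite -(pmulr_lle0 _ d0); lra.
  rewrite mulrNz -/Y.
  move=> h /eqP; rewrite mulf_eq0 subr_eq0 addr_eq0 => /orP[/eqP xy|//].
  have y0 : Y = 0.
    move: h; rewrite xy => h; apply/eqP.
    by rewrite -sqrf_eq0 eq_le sqr_ge0 andbT; exact: h.
  by rewrite xy y0 oppr0.
Qed.

(** * Vertices and circles *)

(** The coefficient matrix sends the lift of [x] to a multiple of the lift of [y]: after
    cross-multiplication the determinant of $(a, b)$ factors out and cancels. *)
Lemma gpoint_eq (R : realType) (a b : gvec) (al be ga de : gint)
    (x y : option R) : gdet a b \is a GRing.unit ->
  gpoint (al *: a + be *: b) (ga *: a + de *: b) x = gpoint a b y ->
  (gint_to_C R al * (hlift x).1%:C + gint_to_C R ga * (hlift x).2%:C) *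
    (hlift y).2%:C =
  (gint_to_C R be * (hlift x).1%:C + gint_to_C R de * (hlift x).2%:C) *
    (hlift y).1%:C.
Proof.
move=> ab; rewrite !gpointE => /hproj_eq.
rewrite !mxE !rmorphD !rmorphM => E.
have g0 : gint_to_C R (gdet a b) != 0 by rewrite -unitfE rmorph_unit.
apply: (mulIf g0); rewrite /gdet rmorphB !rmorphM /=.
apply/eqP; rewrite -subr_eq0; apply/eqP.
move/eqP: E; rewrite -subr_eq0 => /eqP E; rewrite -[RHS]E; ring.
Qed.

Lemma gint_det_lines (R : realType) (al be ga de : gint) (l : R[i])
    (d t1 t2 t3 t4 : R) :
  0 < d -> al * de - be * ga \is a GRing.unit ->
  gint_to_C R (al * de - be * ga) = l ^+ 2 * d%:C ->
  gint_to_C R al = l * t1%:C -> gint_to_C R be = l * t2%:C ->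
  gint_to_C R ga = l * t3%:C -> gint_to_C R de = l * t4%:C ->
  exists (e : gint) (p q r s : int),
    [/\ e \is a GRing.unit, p * s - q * r = 1, al = e * p%:~R /\ be = e * q%:~R
      & ga = e * r%:~R /\ de = e * s%:~R].
Proof.
move=> d0 ku kE.
have intE (n : int) : n%:~R = GInt n 0.
  have natE (m : nat) : m%:R = GInt m 0.
    by elim: m => [//|m IH]; rewrite mulrS IH; congr GInt => /=; lia.
  by case: n => n; rewrite ?NegzE ?mulrNz -pmulrn natE.
case: al be ga de ku kE => [a1 a2] [b1 b2] [c1 c2] [d1 d2] ku kE.
move=> /(gint_on_line d0 kE) [A1 A2 A3 A4] /(gint_on_line d0 kE) [B1 B2 B3 B4].
move=> /(gint_on_line d0 kE) [C1 C2 C3 C4] /(gint_on_line d0 kE) [D1 D2 D3 D4].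
have : GInt a1 a2 * GInt d1 d2 - GInt b1 b2 * GInt c1 c2 \in gint_unit by [].
rewrite !inE => /or4P[]/eqP K.
- have := K; move: (A1 K) (B1 K) (C1 K) (D1 K) => -> -> -> -> [K1 _].
  exists 1, a1, b1, c1, d1; rewrite !mul1r !intE; split=> //.
  by rewrite -[RHS]K1; ring.
- have := K; move: (A2 K) (B2 K) (C2 K) (D2 K) => -> -> -> -> [K1 _].
  exists gI, a2, b2, c2, d2; rewrite !intE; split=> //.
  + by apply: oppr_inj; rewrite -[RHS]K1; ring.
  + by split; congr GInt; rewrite /=; ring.
  + by split; congr GInt; rewrite /=; ring.
(* On a diagonal all entries are integer multiples of $1 + i$ or of $1 - i$, so the determinant has
   even imaginary part and cannot be $\pm i$. *)
- have := K; move: (A3 K) (B3 K) (C3 K) (D3 K) => -> -> -> -> [_ K2]; exfalso; lia.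
- have := K; move: (A4 K) (B4 K) (C4 K) (D4 K) => -> -> -> -> [_ K2]; exfalso; lia.
Qed.

(** The images of $0, 1, \infty$ under the second map have parameters [x], [y], [z] in the first.
    Those of $\infty$ and $0$ make the coefficient columns complex multiples $l$, $m$ of real
    vectors, and that of $1$ makes $m/l$ real. *)
Lemma image_lax_equiv (R : realType) (a b a' b' : gvec) :
  gdet a b \is a GRing.unit -> gdet a' b' \is a GRing.unit ->
  gaussian_image R (row_mx a b) = gaussian_image R (row_mx a' b') ->
  lax_equiv a b a' b'.
Proof.
move=> ab; have /gbasisP basis := ab.
have [[al be] [/= -> _]] := basis a'; have [[ga de] [/= -> _]] := basis b'.
rewrite gdet_comb unitrM => /andP[ku _] E.
have := congr1 (@positive_triples R) E; rewrite !gaussian_image_triples => T.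
set u := al *: a + be *: b in E T; set v := ga *: a + de *: b in E T.
have : [set t | exists x y z : option R, cyclic_lt x y z /\
     t = (gpoint u v x, gpoint u v y, gpoint u v z)]
    (gpoint u v (Some 0), gpoint u v (Some 1), gpoint u v None).
  by exists (Some 0), (Some 1), None; rewrite /cyclic_lt /= ltr01.
rewrite -T => -[x [y [z [xyz [/(gpoint_eq ab) + /(gpoint_eq ab) + /(gpoint_eq ab)]]]]].
rewrite /= !mulr1 !mulr0 !addr0 !add0r => /hlift_line [m [gaE deE]] yE.
move=> /hlift_line [l [alE beE]].
move: xyz; rewrite cyclic_ltE => D.
set X := hlift x in D gaE deE; set Y := hlift y in D yE.
set Z := hlift z in D alE beE.
have XY0 : hdet X Y != 0 by apply: contraTneq D => ->; rewrite !mul0r ltxx.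
pose t := hdet Y Z / hdet X Y.
have mE : m = l * t%:C.
  have XYC : (hdet X Y)%:C != 0 by rewrite fmorph_eq0.
  apply: (mulIf XYC); rewrite -mulrA -rmorphM /t divfK // /hdet.
  apply/eqP; rewrite -subr_eq0; apply/eqP; move/eqP: yE.
  rewrite alE beE gaE deE -subr_eq0 => /eqP yE.
  by rewrite -[RHS]yE !rmorphB !rmorphM; ring.
(* Orientation enters here: this factor is the cyclic order product divided by a square. *)
have d0 : 0 < t * hdet Z X.
  have -> : t * hdet Z X = hdet X Y * hdet Y Z * hdet Z X / (hdet X Y) ^+ 2.
    by rewrite /t; field.
  by rewrite divr_gt0 // exprn_even_gt0 //= .
clearbody t; have kE : gint_to_C R (al * de - be * ga) = l ^+ 2 * (t * hdet Z X)%:C.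
  rewrite rmorphB !rmorphM /= alE beE gaE deE mE /hdet rmorphB !rmorphM.
  ring.
have gaE' : gint_to_C R ga = l * (t * X.1)%:C by rewrite gaE mE rmorphM mulrA.
have deE' : gint_to_C R de = l * (t * X.2)%:C by rewrite deE mE rmorphM mulrA.
have [e [p [q [r [s [eu det [pE qE] [rE sE]]]]]]] :=
  gint_det_lines d0 ku kE alE beE gaE' deE'.
exists e, p, q, r, s; split=> //.
  by rewrite /u pE qE scalerDr !scalerA.
by rewrite /v rE sE scalerDr !scalerA.
Qed.

Lemma vertex_corner (x : kingdom_vertex) : exists c a b,
  sval x = glue_class c /\ std_corner c a b.
Proof.
case: x => X /= [c ->]; have [a [b h]] := corner_std c.
by exists c, a, b.
Qed.

(** This makes the map well defined: a label read at any corner of the class, in any presentation of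
    its chamber, is equivalent to the pair of one fixed corner. *)
Lemma vertex_label_equiv (x : kingdom_vertex) (c : corner) (a b a' b' : gvec) :
  sval x = glue_class c -> std_corner c a b ->
  vertex_label x (lax_lattice a' b') -> lax_equiv a b a' b'.
Proof.
move=> xE hc [d [a1 [b1 [xd /carries_std[a2 [b2 [hd e]]] /lax_lattice_equiv e']]]].
rewrite xE in xd.
have := glue_class_equiv hc hd xd.
move=> /lax_equiv_trans; apply.
apply: lax_equiv_sym; exact: lax_equiv_trans e' e.
Qed.

Lemma glue_class_eq (c d : corner) :
  clos_refl_sym_trans corner glued c d -> glue_class c = glue_class d.
Proof.
move=> h; apply/seteqP; split=> f hf.
  exact: rst_trans (rst_sym _ _ _ _ h) hf.
exact: rst_trans h hf.
Qed.

Lemma sval_irrelevance (T : Type) (P : T -> Prop) : injective (@sval T P).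
Proof.
move=> [x p] [y q] /= xy; rewrite {}xy in p *.
by congr exist; exact: Prop_irrelevance.
Qed.

Theorem theorem3p7 (R : realType) :
  (forall x : kingdom_vertex, exists a b : gvec,
     gbasis a b /\ vertex_label x (lax_lattice a b)) /\
  exists Phi : kingdom_vertex -> gaussian_circle R,
    (forall (x : kingdom_vertex) (a b : gvec),
       gbasis a b -> vertex_label x (lax_lattice a b) ->
       sval (Phi x) = gaussian_image R (row_mx a b)) /\
    bijective Phi.
Proof.
split=> [x|].
  have [c [a [b [xE hc]]]] := vertex_corner x.
  exists a, b; split; first by apply/gbasisP; case: hc.
  exists c, a, b; split=> //; last exact: std_carries.
  by rewrite xE; exact: rst_refl.
(* The map is chosen through an arbitrary standard pair at each vertex. *)
have PhiP (x : kingdom_vertex) : exists o : gaussian_circle R,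
    exists c a b, [/\ sval x = glue_class c, std_corner c a b
      & sval o = gaussian_image R (row_mx a b)].
  have [c [a [b [xE hc]]]] := vertex_corner x.
  have P : exists2 M : 'M[gint]_2, M \in unitmx &
      gaussian_image R (row_mx a b) = gaussian_image R M.
    by exists (row_mx a b) => //; apply/gbasis_unitmx/gbasisP; case: hc.
  by exists (exist (fun o => exists2 M : 'M[gint]_2, M \in unitmx &
    o = gaussian_image R M) _ P), c, a, b.
have [Phi {}PhiP] := choice PhiP.
exists Phi; split=> [x a b ab xab|].
  have [c [a1 [b1 [xE hc ->]]]] := PhiP x.
  exact/lax_equiv_image/(vertex_label_equiv xE hc xab).
have inj : injective Phi.
  move=> x y xy; have [c [a [b [xE hc oE]]]] := PhiP x.
  have [d [a' [b' [yE hd oE']]]] := PhiP y.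
  have e : lax_equiv a b a' b'.
    apply: (@image_lax_equiv R); [by case: hc | by case: hd|].
    by rewrite -oE -oE' xy.
  apply: sval_irrelevance; rewrite xE yE.
  exact/glue_class_eq/(equiv_glue_class hc hd e).
have surj (o : gaussian_circle R) : exists x, Phi x = o.
  case: o => o P; have [M Mu oE] := P.
  (* The columns of [M] have unit determinant, so they are a standard pair of some corner, and the
     class of that corner maps to the circle. *)
  pose a : gvec := col 0 M; pose b : gvec := col 1 M.
  have ME : M = row_mx a b.
    apply/matrixP => i j; have [->|->] : j = 0 \/ j = 1.
    - by case: j => [[|[|//]] ?]; [left | right]; apply: val_inj.
    - by rewrite row_mx_ent mxE.
    - by rewrite row_mx_ent mxE.
  have ab : gdet a b \is a GRing.unit.
    by apply/gbasisP/gbasis_unitmx; rewrite -ME.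
  have [c hc] := std_corner_exists ab.
  have xP : exists c', glue_class c = glue_class c' by exists c.
  pose x : kingdom_vertex := exist (fun X => exists c, X = glue_class c) _ xP.
  exists x; have [d [a' [b' [/= xE hd sE]]]] := PhiP x.
  apply: sval_irrelevance; rewrite sE /= oE ME; apply: lax_equiv_image.
  have : glue_class d c by rewrite -xE; exact: rst_refl.
  exact: glue_class_equiv hd hc.
(* A right inverse of an injective map is a two-sided inverse. *)
have [Psi PsiK] := choice surj.
by exists Psi => // x; apply: inj; rewrite PsiK.
Qed.
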